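(* Let $\mathbf W$ and $\mathbf F$ be the categories of finitely generated free monoids and of finitely generated free groups. The groupification functor $\mathbf W^{\mathsf o}\to\mathbf F^{\mathsf o}$ induces an isomorphism of monads $\Phi_{\mathbf W^{\mathsf o}}\to\Phi_{\mathbf F^{\mathsf o}}$ and an isomorphism of the associated bimodules $\mathtt L_{\mathbf W^{\mathsf o}}/\mathtt I^{\mathsf{pr}}_{\mathbf W^{\mathsf o}}\to\mathtt L_{\mathbf F^{\mathsf o}}/\mathtt I^{\mathsf{pr}}_{\mathbf F^{\mathsf o}}$ (where the target is regarded as an $(\mathtt L_{\mathbf W^{\mathsf o}},\Phi_{\mathbf W^{\mathsf o}})$-bimodule via the induced monad maps $\mathtt L_{\mathbf W^{\mathsf o}}\to\mathtt L_{\mathbf F^{\mathsf o}}$ and $\Phi_{\mathbf W^{\mathsf o}}\to\Phi_{\mathbf F^{\mathsf o}}$).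
   Context: $\Bbbk$ is a fixed commutative unital ring; $\mathbb N=\{0,1,2,\dots\}$. Monads. A monad $\mathtt T$ on a set $\mathcal X$ (in the bicategory of matrices of $\Bbbk$-modules) is a family of $\Bbbk$-modules $\mathtt T(Y,X)$ with associative bilinear composition $\mathtt T(Z,Y)\otimes\mathtt T(Y,X)\to\mathtt T(Z,X)$ and units. For monads $\mathtt T,\mathtt S$ on $\mathcal X,\mathcal Y$, a $(\mathtt T,\mathtt S)$-bimodule is a family $\mathtt B(X,Y)$ with commuting associative unital actions $\mathtt T(X',X)\otimes\mathtt B(X,Y)\to\mathtt B(X',Y)$ and $\mathtt B(X,Y)\otimes\mathtt S(Y,Y')\to\mathtt B(X,Y')$. For a left ideal $\mathtt J\subset\mathtt T$ (submodules with $\mathtt T\circ\mathtt J\subset\mathtt J$), $\mathrm{Iz}(\mathtt J)(Y,X)=\{f\in\mathtt T(Y,X):\mathtt J(Z,Y)\circ f\subset\mathtt J(Z,X)\ \forall Z\}$, and the eigenmonad is $\mathrm E_{\mathtt T}(\mathtt J)=\mathrm{Iz}(\mathtt J)/\mathtt J$. Composition in $\mathtt T$ makes $\mathtt T/\mathtt J$ a $(\mathtt T,\mathrm E_{\mathtt T}(\mathtt J))$-bimodule (the associated canonical bimodule). Lawvere theories. A Lawvere theory is a category $\mathcal C$ with finite products and object set $\mathbb N$, the product on objects being addition. $\mathtt L_{\mathcal C}(m,n)=\Bbbk[\mathcal C(n,m)]$ is the associated monad on $\mathbb N$. If $\mathcal C$ has a zero object, let $\Delta\in\mathcal C(1,2)$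 be the diagonal, $\eta\in\mathcal C(0,1)$ the zero morphism, $\bar\Delta^{n,k}=\mathrm{id}_{k-1}\times\Delta\times\mathrm{id}_{n-k}-\mathrm{id}_k\times\eta\times\mathrm{id}_{n-k}-\mathrm{id}_{k-1}\times\eta\times\mathrm{id}_{n-k+1}\in\mathtt L_{\mathcal C}(n+1,n)$ for $n\ge1$, $1\le k\le n$. $\mathtt I^{\mathsf{pr}}_{\mathcal C}$ is the left ideal of $\mathtt L_{\mathcal C}$ generated by all $\bar\Delta^{n,k}$, and $\Phi_{\mathcal C}=\mathrm E_{\mathtt L_{\mathcal C}}(\mathtt I^{\mathsf{pr}}_{\mathcal C})$. In $\mathbf W$ (resp. $\mathbf F$) the object $n$ is the free monoid $\mathsf W_n$ (resp. free group $\mathsf F_n$) on $x_1,\dots,x_n$, so $\mathbf W^{\mathsf o}(n,m)\cong\mathsf W_n^{\times m}$ and $\mathbf F^{\mathsf o}(n,m)\cong\mathsf F_n^{\times m}$; both are Lawvere theories with a zero object. The groupification functor is induced by $\mathsf W_n\subset\mathsf F_n$. *)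

(* Defs.v *)
From HB Require Import structures.
From mathcomp Require Import all_boot all_algebra.
From mathcomp Require Import finmap boolp.
From mathcomp Require Import monalg.
From mathcomp Require Import zify.

Set Implicit Arguments.
Unset Strict Implicit.
Unset Printing Implicit Defensive.

Import GRing.Theory.
Local Open Scope ring_scope.
Local Obligation Tactic := idtac.

(* Submodules are predicates in Prop, so that they may be defined by           *)
(* quantifying over all ideals or all objects; classical logic then provides   *)
(* the associated submodule type and quotient module.                          *)

Record submod (K : comPzRingType) (V : lmodType K) := Submod {
  smod_mem :> V -> Prop;
  smod0 : smod_mem 0;
  smodP : forall (a : K) u v,
    smod_mem u -> smod_mem v -> smod_mem (a *: u + v)
}.

Section Submodules.
Variables (K : comPzRingType) (V : lmodType K) (N : submod V).

Definition smod_pred : {pred V} := fun v => `[< N v >].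

Lemma smod_predE v : (v \in smod_pred) = `[< N v >]. Proof. by []. Qed.

Fact smod_submod_closed : submod_closed smod_pred.
Proof.
split=> [|a u v]; rewrite ?smod_predE; first exact/asboolP/smod0.
by move=> /asboolP Nu /asboolP Nv; apply/asboolP/smodP.
Qed.

HB.instance Definition _ := GRing.isSubmodClosed.Build K V smod_pred
  smod_submod_closed.
HB.instance Definition _ := GRing.isOppClosed.Build V smod_pred
  (GRing.zmod_closedN (GRing.submod_closedB smod_submod_closed)).

Definition sub_mod : Type := {v : V | v \in smod_pred}.
HB.instance Definition _ := [isSub of sub_mod for @sval _ _].
HB.instance Definition _ := [Choice of sub_mod by <:].
HB.instance Definition _ := [SubChoice_isSubLmodule of sub_mod by <:].

Lemma sub_modP (u : sub_mod) : N (val u).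
Proof. exact/asboolP/(valP u). Qed.

Lemma sub_valP (a : K) (u v : sub_mod) : val (a *: u + v) = a *: val u + val v.
Proof. exact: linearP. Qed.

Definition mk_sub (v : V) (Nv : N v) : sub_mod := exist _ v (asboolT Nv).

Definition quot_mod : Type := Quotient.quot smod_pred.
HB.instance Definition _ := GRing.Zmodule.on quot_mod.

Definition qproj (v : V) : quot_mod := \pi_(Quotient.quot smod_pred)%qT v.

Lemma qprojP u v : qproj u = qproj v <-> N (u - v).
Proof.
by split=> [/eqP|Nuv]; [|apply/eqP]; rewrite -Quotient.idealrBE smod_predE;
  [move/asboolP|exact/asboolP].
Qed.

Definition qrepr (q : quot_mod) : V := repr (q : Quotient.quot smod_pred).

Lemma qreprK : cancel qrepr qproj. Proof. exact: reprK. Qed.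

Lemma quotW (P : quot_mod -> Prop) : (forall v, P (qproj v)) -> forall q, P q.
Proof. by move=> Pv q; rewrite -[q]qreprK. Qed.

Lemma qprojD u v : qproj (u + v) = qproj u + qproj v.
Proof. exact: Quotient.pi_add. Qed.

Lemma qproj0 : qproj 0 = 0.
Proof. by apply: (addIr (qproj 0)); rewrite -qprojD !add0r. Qed.

Definition qscale (a : K) (q : quot_mod) : quot_mod := qproj (a *: qrepr q).

Lemma smodB u v : N u -> N v -> N (u - v).
Proof. by move=> Nu Nv; rewrite addrC -scaleN1r; apply: smodP. Qed.

Lemma smodZ a u : N u -> N (a *: u).
Proof. by move=> Nu; rewrite -[_ *: _]addr0; apply/smodP/smod0. Qed.

Lemma qscaleE a v : qscale a (qproj v) = qproj (a *: v).
Proof. by apply/qprojP; rewrite -scalerBr; apply/smodZ/qprojP/qreprK. Qed.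

Fact qscaleA a b q : qscale a (qscale b q) = qscale (a * b) q.
Proof. by elim/quotW: q => v; rewrite !qscaleE scalerA. Qed.
Fact qscale1 : left_id 1 qscale.
Proof. by elim/quotW=> v; rewrite qscaleE scale1r. Qed.
Fact qscaleDr : right_distributive qscale +%R.
Proof.
move=> a; elim/quotW=> u; elim/quotW=> v.
by rewrite -qprojD !qscaleE scalerDr qprojD.
Qed.
Fact qscaleDl q a b : qscale (a + b) q = qscale a q + qscale b q.
Proof. by elim/quotW: q => v; rewrite !qscaleE scalerDl qprojD. Qed.

HB.instance Definition _ := GRing.Zmodule_isLmodule.Build K quot_mod
  qscaleA qscale1 qscaleDr qscaleDl.

Lemma qprojZ a v : qproj (a *: v) = a *: qproj v.
Proof. by rewrite -qscaleE. Qed.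

Fact qproj_linear : linear qproj.
Proof. by move=> a u v; rewrite qprojD qprojZ. Qed.
HB.instance Definition _ := GRing.isLinear.Build K V quot_mod _ qproj
  qproj_linear.

End Submodules.

(* {malg K[X]} is a K-module in the library only for nonzero K; the alias      *)
(* below covers the zero ring too.                                             *)
Section FreeModule.
Variables (K : comPzRingType) (X : choiceType).

Definition freemod : Type := {malg K[X]}.
HB.instance Definition _ := GRing.Zmodule.on freemod.

Definition fm_coef (x : X) (u : freemod) : K := mcoeff x u.
Definition fm_supp (u : freemod) : {fset X} := msupp u.
Definition fm_basis (x : X) : freemod := mkmalgU x 1.

Definition fm_scale (a : K) (u : freemod) : freemod :=
  \sum_(x <- fm_supp u) (mkmalgU x (a * fm_coef x u) : freemod).

Lemma fm_ext (u v : freemod) : (forall x, fm_coef x u = fm_coef x v) -> u = v.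
Proof. by move=> uv; apply/malgP. Qed.

Lemma fm_coefD x u v : fm_coef x (u + v) = fm_coef x u + fm_coef x v.
Proof. exact: mcoeffD. Qed.

Lemma fm_coef0 x : fm_coef x 0 = 0. Proof. exact: mcoeff0. Qed.

Lemma fm_coef_sum x (I : Type) (r : seq I) (f : I -> freemod) :
  fm_coef x (\sum_(i <- r) f i) = \sum_(i <- r) fm_coef x (f i).
Proof. exact: (big_morph _ (fm_coefD x) (fm_coef0 x)). Qed.

Lemma fm_scaleE a u x : fm_coef x (fm_scale a u) = a * fm_coef x u.
Proof.
rewrite fm_coef_sum /fm_coef; have [xu|xNu] := boolP (x \in msupp u).
  rewrite (big_fsetD1 x) //= mcoeffUU big1_fset ?addr0 // => y.
  by rewrite in_fsetD1 mcoeffU => /andP[/negPf-> _].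
rewrite big1_fset ?(mcoeff_outdom xNu) ?mulr0 // => y yu _.
by rewrite mcoeffU; case: eqP yu xNu => // ->; rewrite /fm_supp => ->.
Qed.

Fact fm_scaleA a b u : fm_scale a (fm_scale b u) = fm_scale (a * b) u.
Proof. by apply/fm_ext=> x; rewrite !fm_scaleE mulrA. Qed.
Fact fm_scale1 : left_id 1 fm_scale.
Proof. by move=> u; apply/fm_ext=> x; rewrite fm_scaleE mul1r. Qed.
Fact fm_scaleDr : right_distributive fm_scale +%R.
Proof. by move=> a u v; apply/fm_ext=> x; rewrite !(fm_scaleE, fm_coefD) mulrDr. Qed.
Fact fm_scaleDl u a b : fm_scale (a + b) u = fm_scale a u + fm_scale b u.
Proof. by apply/fm_ext=> x; rewrite !(fm_scaleE, fm_coefD) mulrDl. Qed.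

HB.instance Definition _ := GRing.Zmodule_isLmodule.Build K freemod
  fm_scaleA fm_scale1 fm_scaleDr fm_scaleDl.

Lemma fm_coefZ x a u : fm_coef x (a *: u) = a * fm_coef x u.
Proof. exact: fm_scaleE. Qed.

Lemma fm_decomp u : u = \sum_(x <- fm_supp u) fm_coef x u *: fm_basis x.
Proof.
rewrite [LHS]monalgE; apply: eq_bigr => x _; apply/fm_ext => y.
by rewrite fm_coefZ /fm_coef !mcoeffU mulrnAr mulr1.
Qed.

Definition linext (V : lmodType K) (f : X -> V) (u : freemod) : V :=
  \sum_(x <- fm_supp u) fm_coef x u *: f x.

Section LinearExtension.
Variables (V : lmodType K) (f : X -> V).

Lemma linextE (d : {fset X}) u : (fm_supp u `<=` d)%fset ->
  linext f u = \sum_(x <- d) fm_coef x u *: f x.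
Proof.
move=> sud; apply: big_fset_incl => // x _ xNu.
by rewrite /fm_coef mcoeff_outdom ?scale0r.
Qed.

Fact linext_linear : linear (linext f).
Proof.
move=> a u v; pose d := (fm_supp (a *: u + v)%R `|` (fm_supp u `|` fm_supp v))%fset.
rewrite !(@linextE d) ?fsubsetUl //; last first.
- by rewrite fsubsetU // fsubsetUl orbT.
- by rewrite fsubsetU // fsubsetUr orbT.
rewrite scaler_sumr -big_split; apply: eq_bigr => x _ /=.
by rewrite fm_coefD fm_coefZ scalerDl scalerA.
Qed.
HB.instance Definition _ := GRing.isLinear.Build K freemod V _ (linext f)
  linext_linear.

Lemma linext_basis x : linext f (fm_basis x) = f x.
Proof.
rewrite (@linextE [fset x]%fset); last exact: msuppU_le.
by rewrite big_seq_fset1 /fm_coef mcoeffUU scale1r.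
Qed.

End LinearExtension.

Lemma fm_linear_ext (V : lmodType K) (f g : freemod -> V) :
  linear f -> linear g -> (forall x, f (fm_basis x) = g (fm_basis x)) ->
  f =1 g.
Proof.
move=> lf lg fg u; pose F := GRing.isLinear.Build K freemod V _ f lf.
pose G := GRing.isLinear.Build K freemod V _ g lg.
pose f' : {linear freemod -> V} := HB.pack f F.
pose g' : {linear freemod -> V} := HB.pack g G.
rewrite -[f u]/(f' u) -[g u]/(g' u) (fm_decomp u) !linear_sum.
by apply: eq_bigr => x _; rewrite !linearZ /= fg.
Qed.

End FreeModule.

Section Monads.
Variables (K : comPzRingType) (X : Type).

(* T Y X is the module of morphisms from X to Y, so that composition is        *)
(* written in the order of functions.                                          *)
Record monad := Monad {
  mhom :> X -> X -> lmodType K;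
  mcomp : forall Z Y W, mhom Z Y -> mhom Y W -> mhom Z W;
  mone : forall Y, mhom Y Y;
  mcomp_linearl : forall Z Y W (f : mhom Y W), linear (fun g => @mcomp Z Y W g f);
  mcomp_linearr : forall Z Y W (g : mhom Z Y), linear (@mcomp Z Y W g);
  mcompA : forall Z Y W V (h : mhom Z Y) (g : mhom Y W) (f : mhom W V),
    mcomp h (mcomp g f) = mcomp (mcomp h g) f;
  mcomp1m : forall Z Y (f : mhom Z Y), mcomp (mone Z) f = f;
  mcompm1 : forall Z Y (f : mhom Z Y), mcomp f (mone Y) = f
}.

Record monad_mor (T S : monad) := MonadMor {
  mmor :> forall Y W, {linear T Y W -> S Y W};
  mmor_comp : forall Z Y W (g : T Z Y) (f : T Y W),
    mmor Z W (mcomp g f) = mcomp (mmor Z Y g) (mmor Y W f);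
  mmor_one : forall Y, mmor Y Y (mone T Y) = mone S Y
}.

Definition monad_iso (T S : monad) (h : monad_mor T S) : Prop :=
  exists h' : monad_mor S T, forall Y W,
    cancel (h Y W) (h' Y W) /\ cancel (h' Y W) (h Y W).

Record lideal (T : monad) := LIdeal {
  lideal_mod :> forall Y W, submod (T Y W);
  lideal_comp : forall Z Y W (g : T Z Y) (f : T Y W),
    lideal_mod Y W f -> lideal_mod Z W (mcomp g f)
}.

Section GeneratedLeftIdeal.
Variables (T : monad) (G : forall Y W, T Y W -> Prop).

Definition lgen_mem Y W (f : T Y W) : Prop :=
  forall J : lideal T, (forall Y' W' (g : T Y' W'), G g -> J Y' W' g) -> J Y W f.

Fact lgen_mem0 Y W : @lgen_mem Y W 0.
Proof. by move=> J _; apply: smod0. Qed.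
Fact lgen_memP Y W (a : K) (f g : T Y W) :
  lgen_mem f -> lgen_mem g -> lgen_mem (a *: f + g).
Proof. by move=> If Ig J GJ; apply: smodP; [apply: If | apply: Ig]. Qed.
Fact lgen_mem_comp Z Y W (g : T Z Y) (f : T Y W) :
  lgen_mem f -> lgen_mem (mcomp g f).
Proof. by move=> If J GJ; apply/lideal_comp/If. Qed.

Definition lideal_gen : lideal T :=
  @LIdeal T (fun Y W => Submod (@lgen_mem0 Y W) (@lgen_memP Y W)) lgen_mem_comp.

End GeneratedLeftIdeal.

End Monads.

Section Bimodules.
Variables (K : comPzRingType) (X Y : Type).

Record bimod (T : monad K X) (S : monad K Y) := Bimod {
  bhom :> X -> Y -> lmodType K;
  lact : forall x' x y, T x' x -> bhom x y -> bhom x' y;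
  ract : forall x y y', bhom x y -> S y y' -> bhom x y';
  lact_linearl : forall x' x y (b : bhom x y), linear (fun t => @lact x' x y t b);
  lact_linearr : forall x' x y (t : T x' x), linear (@lact x' x y t);
  ract_linearl : forall x y y' (s : S y y'), linear (fun b => @ract x y y' b s);
  ract_linearr : forall x y y' (b : bhom x y), linear (@ract x y y' b);
  lactA : forall x'' x' x y (u : T x'' x') (t : T x' x) (b : bhom x y),
    lact u (lact t b) = lact (mcomp u t) b;
  lact1 : forall x y (b : bhom x y), lact (mone T x) b = b;
  ractA : forall x y y' y'' (b : bhom x y) (s : S y y') (u : S y' y''),
    ract (ract b s) u = ract b (mcomp s u);
  ract1 : forall x y (b : bhom x y), ract b (mone S y) = b;
  lractA : forall x' x y y' (t : T x' x) (b : bhom x y) (s : S y y'),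
    lact t (ract b s) = ract (lact t b) s
}.

Record bimod_mor (T : monad K X) (S : monad K Y) (B C : bimod T S) := BimodMor {
  bmor :> forall x y, {linear B x y -> C x y};
  bmor_lact : forall x' x y (t : T x' x) (b : B x y),
    bmor x' y (lact t b) = lact t (bmor x y b);
  bmor_ract : forall x y y' (b : B x y) (s : S y y'),
    bmor x y' (ract b s) = ract (bmor x y b) s
}.

Definition bimod_iso (T : monad K X) (S : monad K Y) (B C : bimod T S)
    (h : bimod_mor B C) : Prop :=
  exists h' : bimod_mor C B, forall x y,
    cancel (h x y) (h' x y) /\ cancel (h' x y) (h x y).

Section Restriction.
Variables (T T' : monad K X) (S S' : monad K Y).
Variables (h : monad_mor T T') (k : monad_mor S S') (B : bimod T' S').

Definition restr_lact x' x y (t : T x' x) (b : B x y) : B x' y :=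
  lact (h x' x t) b.
Definition restr_ract x y y' (b : B x y) (s : S y y') : B x y' :=
  ract b (k y y' s).

Program Definition bimod_restr : bimod T S :=
  @Bimod T S (bhom B) restr_lact restr_ract _ _ _ _ _ _ _ _ _.
Next Obligation.
by move=> x' x y b a t u; rewrite /restr_lact linearP lact_linearl.
Qed.
Next Obligation. by move=> x' x y t a b c; apply: lact_linearr. Qed.
Next Obligation. by move=> x y y' s a b c; apply: ract_linearl. Qed.
Next Obligation.
by move=> x y y' b a s u; rewrite /restr_ract linearP ract_linearr.
Qed.
Next Obligation.
by move=> x'' x' x y u t b; rewrite /restr_lact lactA mmor_comp.
Qed.
Next Obligation. by move=> x y b; rewrite /restr_lact mmor_one lact1. Qed.
Next Obligation.
by move=> x y y' y'' b s u; rewrite /restr_ract ractA mmor_comp.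
Qed.
Next Obligation. by move=> x y b; rewrite /restr_ract mmor_one ract1. Qed.
Next Obligation. by move=> x' x y y' t b s; apply: lractA. Qed.

End Restriction.
End Bimodules.

Section Eigenmonad.
Variables (K : comPzRingType) (X : Type) (T : monad K X) (J : lideal T).

Lemma mcomp0m Z Y W (f : T Y W) : mcomp (0 : T Z Y) f = 0.
Proof.
have := mcomp_linearl f (-1) (0 : T Z Y) 0.
by rewrite scaler0 addr0 scaleN1r addNr.
Qed.
Lemma mcompm0 Z Y W (g : T Z Y) : mcomp g (0 : T Y W) = 0.
Proof.
have := mcomp_linearr g (-1) (0 : T Y W) 0.
by rewrite scaler0 addr0 scaleN1r addNr.
Qed.
Lemma mcompBm Z Y W (g g' : T Z Y) (f : T Y W) :
  mcomp (g - g') f = mcomp g f - mcomp g' f.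
Proof.
by rewrite addrC -scaleN1r (mcomp_linearl f) scaleN1r addrC.
Qed.
Lemma mcompmB Z Y W (g : T Z Y) (f f' : T Y W) :
  mcomp g (f - f') = mcomp g f - mcomp g f'.
Proof.
by rewrite addrC -scaleN1r (mcomp_linearr g) scaleN1r addrC.
Qed.

Definition Iz_mem Y W (f : T Y W) : Prop :=
  forall Z (g : T Z Y), J Z Y g -> J Z W (mcomp g f).

Fact Iz_mem0 Y W : @Iz_mem Y W 0.
Proof. by move=> Z g _; rewrite mcompm0; apply: smod0. Qed.
Fact Iz_memP Y W (a : K) (f f' : T Y W) :
  Iz_mem f -> Iz_mem f' -> Iz_mem (a *: f + f').
Proof.
by move=> If If' Z g Jg; rewrite mcomp_linearr; apply: smodP; [apply: If|apply: If'].
Qed.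
Definition Iz Y W : submod (T Y W) := Submod (@Iz_mem0 Y W) (@Iz_memP Y W).

Lemma Iz_one Y : Iz Y Y (mone T Y).
Proof. by move=> Z g; rewrite mcompm1. Qed.
Lemma Iz_comp Z Y W (g : T Z Y) (f : T Y W) :
  Iz Z Y g -> Iz Y W f -> Iz Z W (mcomp g f).
Proof. by move=> Ig If V h Jh; rewrite mcompA; apply/If/Ig. Qed.

Definition izone Y : sub_mod (Iz Y Y) := mk_sub (@Iz_one Y).
Definition izcomp Z Y W (g : sub_mod (Iz Z Y)) (f : sub_mod (Iz Y W)) :
  sub_mod (Iz Z W) := mk_sub (Iz_comp (sub_modP g) (sub_modP f)).

Lemma izcompE Z Y W (g : sub_mod (Iz Z Y)) (f : sub_mod (Iz Y W)) :
  val (izcomp g f) = mcomp (val g) (val f).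
Proof. by []. Qed.

Definition J_in_Iz_mem Y W (f : sub_mod (Iz Y W)) : Prop := J Y W (val f).
Fact J_in_Iz_mem0 Y W : @J_in_Iz_mem Y W 0.
Proof. by rewrite /J_in_Iz_mem raddf0; apply: smod0. Qed.
Fact J_in_Iz_memP Y W (a : K) (f g : sub_mod (Iz Y W)) :
  J_in_Iz_mem f -> J_in_Iz_mem g -> J_in_Iz_mem (a *: f + g).
Proof. by rewrite /J_in_Iz_mem linearP; apply: smodP. Qed.
Definition J_in_Iz Y W : submod (sub_mod (Iz Y W)) :=
  Submod (@J_in_Iz_mem0 Y W) (@J_in_Iz_memP Y W).

Lemma lideal_sub_Iz Y W (f : T Y W) : J Y W f -> Iz Y W f.
Proof. by move=> Jf Z g _; apply: lideal_comp. Qed.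

Definition ehom Y W : lmodType K := quot_mod (J_in_Iz Y W).
Definition eproj Y W (f : sub_mod (Iz Y W)) : ehom Y W := qproj (J_in_Iz Y W) f.
Definition eone Y : ehom Y Y := eproj (izone Y).
Definition ecomp Z Y W (g : ehom Z Y) (f : ehom Y W) : ehom Z W :=
  eproj (izcomp (qrepr g) (qrepr f)).

Lemma ecompE Z Y W (g : sub_mod (Iz Z Y)) (f : sub_mod (Iz Y W)) :
  ecomp (eproj g) (eproj f) = eproj (izcomp g f).
Proof.
apply/qprojP; rewrite /= /J_in_Iz_mem raddfB /=.
set g' := qrepr _; set f' := qrepr _.
have Jg : J Z Y (val g' - val g).
  by have /qprojP := qreprK (eproj g); rewrite /= /J_in_Iz_mem raddfB.
have Jf : J Y W (val f' - val f).
  by have /qprojP := qreprK (eproj f); rewrite /= /J_in_Iz_mem raddfB.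
have -> : mcomp (val g') (val f') - mcomp (val g) (val f) =
    1 *: mcomp (val g' - val g) (val f') + mcomp (val g) (val f' - val f).
  by rewrite scale1r mcompBm mcompmB addrA subrK.
by apply: smodP; [apply: (sub_modP f')|apply: lideal_comp].
Qed.

Lemma eprojW Y W (P : ehom Y W -> Prop) : (forall f, P (eproj f)) -> forall q, P q.
Proof. exact: quotW. Qed.

Lemma eprojP Y W (a : K) (f g : sub_mod (Iz Y W)) :
  eproj (a *: f + g) = a *: eproj f + eproj g.
Proof. exact: linearP. Qed.

Program Definition eigenmonad : monad K X :=
  @Monad K X ehom ecomp eone _ _ _ _ _.
Next Obligation.
move=> Z Y W; elim/eprojW=> f a; elim/eprojW=> g; elim/eprojW=> g'.
rewrite -eprojP !ecompE -eprojP; congr eproj; apply: val_inj.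
by rewrite sub_valP !izcompE sub_valP mcomp_linearl.
Qed.
Next Obligation.
move=> Z Y W; elim/eprojW=> f a; elim/eprojW=> g; elim/eprojW=> g'.
rewrite -eprojP !ecompE -eprojP; congr eproj; apply: val_inj.
by rewrite sub_valP !izcompE sub_valP mcomp_linearr.
Qed.
Next Obligation.
move=> Z Y W V; elim/eprojW=> h; elim/eprojW=> g; elim/eprojW=> f.
by rewrite !ecompE; congr eproj; apply: val_inj; apply: mcompA.
Qed.
Next Obligation.
move=> Z Y; elim/eprojW=> f.
by rewrite ecompE; congr eproj; apply: val_inj; apply: mcomp1m.
Qed.
Next Obligation.
move=> Z Y; elim/eprojW=> f.
by rewrite ecompE; congr eproj; apply: val_inj; apply: mcompm1.
Qed.

Definition chom Y W : lmodType K := quot_mod (J Y W).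
Definition cproj Y W (f : T Y W) : chom Y W := qproj (J Y W) f.
Definition clact Z Y W (g : T Z Y) (f : chom Y W) : chom Z W :=
  cproj (mcomp g (qrepr f)).
Definition cract Z Y W (g : chom Z Y) (f : ehom Y W) : chom Z W :=
  cproj (mcomp (qrepr g) (val (qrepr f))).

Lemma clactE Z Y W (g : T Z Y) (f : T Y W) :
  clact g (cproj f) = cproj (mcomp g f).
Proof.
by apply/qprojP; rewrite -mcompmB; apply/lideal_comp/qprojP/qreprK.
Qed.

Lemma cractE Z Y W (g : T Z Y) (f : sub_mod (Iz Y W)) :
  cract (cproj g) (eproj f) = cproj (mcomp g (val f)).
Proof.
apply/qprojP; set g' := qrepr _; set f' := qrepr _.
have Jg : J Z Y (g' - g) by apply/qprojP/qreprK.
have Jf : J Y W (val f' - val f).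
  by have /qprojP := qreprK (eproj f); rewrite /= /J_in_Iz_mem raddfB.
have -> : mcomp g' (val f') - mcomp g (val f) =
    1 *: mcomp (g' - g) (val f') + mcomp g (val f' - val f).
  by rewrite scale1r mcompBm mcompmB addrA subrK.
by apply: smodP; [apply: (sub_modP f')|apply: lideal_comp].
Qed.

Lemma cprojW Y W (P : chom Y W -> Prop) : (forall f, P (cproj f)) -> forall q, P q.
Proof. exact: quotW. Qed.

Lemma cprojP Y W (a : K) (f g : T Y W) :
  cproj (a *: f + g) = a *: cproj f + cproj g.
Proof. exact: linearP. Qed.

Program Definition canon_bimod : bimod T eigenmonad :=
  @Bimod K X X T eigenmonad chom clact cract _ _ _ _ _ _ _ _ _.
Next Obligation.
move=> Z Y W; elim/cprojW=> f a g g'.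
by rewrite !clactE -cprojP mcomp_linearl.
Qed.
Next Obligation.
move=> Z Y W g a; elim/cprojW=> f; elim/cprojW=> f'.
by rewrite -cprojP !clactE -cprojP mcomp_linearr.
Qed.
Next Obligation.
move=> Z Y W; elim/eprojW=> f a; elim/cprojW=> g; elim/cprojW=> g'.
by rewrite -cprojP !cractE -cprojP mcomp_linearl.
Qed.
Next Obligation.
move=> Z Y W; elim/cprojW=> g a; elim/eprojW=> f; elim/eprojW=> f'.
by rewrite -eprojP !cractE -cprojP sub_valP mcomp_linearr.
Qed.
Next Obligation.
by move=> V Z Y W h g; elim/cprojW=> f; rewrite !clactE mcompA.
Qed.
Next Obligation. by move=> Y W; elim/cprojW=> f; rewrite clactE mcomp1m. Qed.
Next Obligation.
move=> Z Y W V; elim/cprojW=> h; elim/eprojW=> g; elim/eprojW=> f.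
by rewrite [@mcomp K X eigenmonad _ _ _ _ _]ecompE !cractE mcompA.
Qed.
Next Obligation. by move=> Y W; elim/cprojW=> f; rewrite cractE mcompm1. Qed.
Next Obligation.
move=> Z Y W V h; elim/cprojW=> g; elim/eprojW=> f.
by rewrite cractE !clactE cractE mcompA.
Qed.

End Eigenmonad.

(* Both conditions determine the map on the quotients; the first one includes  *)
(* the fact that h maps Iz(J) into Iz(J'), and both that it maps J into J'.    *)
Section InducedMaps.
Variables (K : comPzRingType) (X : Type) (T S : monad K X).
Variables (J : lideal T) (J' : lideal S) (h : monad_mor T S).

Definition induces_eigen (phi : monad_mor (eigenmonad J) (eigenmonad J')) :=
  forall Y W (f : sub_mod (Iz J Y W)), exists g : sub_mod (Iz J' Y W),
    val g = h Y W (val f) /\ phi Y W (eproj f) = eproj g.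

Definition induces_canon (phi : monad_mor (eigenmonad J) (eigenmonad J'))
    (psi : bimod_mor (canon_bimod J) (bimod_restr h phi (canon_bimod J'))) :=
  forall Y W (f : T Y W), psi Y W (cproj J f) = cproj J' (h Y W f).

End InducedMaps.

(* The hypothesis that the product on objects is addition is understood        *)
(* strictly: products are associative and unital on the nose, with the         *)
(* transports imposed by the provable equalities between sums of integers, so  *)
(* that products of more than two morphisms need no parentheses.               *)
Definition hom_cast (H : nat -> nat -> choiceType) m m' n n' (em : m = m') (en : n = n')
    (f : H m n) : H m' n' :=
  ecast i (H i n') em (ecast j (H m j) en f).
Arguments hom_cast H {m m' n n'} em en f.

Local Open Scope nat_scope.

Record lawvere := Lawvere {
  lhom :> nat -> nat -> choiceType;
  lid : forall n, lhom n n;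
  lcomp : forall l m n, lhom m n -> lhom l m -> lhom l n;
  lcompA : forall k l m n (h : lhom m n) (g : lhom l m) (f : lhom k l),
    lcomp h (lcomp g f) = lcomp (lcomp h g) f;
  lcomp1f : forall m n (f : lhom m n), lcomp (lid n) f = f;
  lcompf1 : forall m n (f : lhom m n), lcomp f (lid m) = f;
  lterm : forall n, lhom n 0;
  lterm_uniq : forall n (f : lhom n 0), f = lterm n;
  lfst : forall m n, lhom (m + n) m;
  lsnd : forall m n, lhom (m + n) n;
  lpair : forall l m n, lhom l m -> lhom l n -> lhom l (m + n);
  lfst_pair : forall l m n (f : lhom l m) (g : lhom l n),
    lcomp (lfst m n) (lpair f g) = f;
  lsnd_pair : forall l m n (f : lhom l m) (g : lhom l n),
    lcomp (lsnd m n) (lpair f g) = g;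
  lpair_uniq : forall l m n (h : lhom l (m + n)),
    h = lpair (lcomp (lfst m n) h) (lcomp (lsnd m n) h);
  lfst0 : forall n, hom_cast lhom (addn0 n) (erefl n) (lfst n 0) = lid n;
  lsnd0 : forall n, lsnd 0 n = lid n;
  lassoc1 : forall m n p,
    hom_cast lhom (addnA m n p) (erefl m) (lfst m (n + p)) =
    lcomp (lfst m n) (lfst (m + n) p);
  lassoc2 : forall m n p,
    hom_cast lhom (addnA m n p) (erefl n) (lcomp (lfst n p) (lsnd m (n + p))) =
    lcomp (lsnd m n) (lfst (m + n) p);
  lassoc3 : forall m n p,
    hom_cast lhom (addnA m n p) (erefl p) (lcomp (lsnd n p) (lsnd m (n + p))) =
    lsnd (m + n) p
}.

Definition lprod (C : lawvere) m n m' n' (f : C m n) (g : C m' n') :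
    C (m + m') (n + n') :=
  lpair (lcomp f (lfst C m m')) (lcomp g (lsnd C m m')).

Definition ldiag (C : lawvere) : C 1 2 := @lpair C 1 1 1 (lid C 1) (lid C 1).

(* A zero object is terminal, hence isomorphic to 0; so 0 is initial.          *)
Record zlawvere := ZLawvere {
  zl_lawvere :> lawvere;
  lzero : forall n, zl_lawvere 0 n;
  lzero_uniq : forall n (f : zl_lawvere 0 n), f = lzero n
}.

Record lfunctor (C D : lawvere) := LFunctor {
  lf_hom :> forall m n, C m n -> D m n;
  lf_id : forall n, lf_hom (lid C n) = lid D n;
  lf_comp : forall l m n (g : C m n) (f : C l m),
    lf_hom (lcomp g f) = lcomp (lf_hom g) (lf_hom f)
}.

Section DeltaBarTypes.
Variables (n k : nat) (hk : 0 < k <= n).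

Fact dbar_dom1 : k.-1 + 1 + (n - k) = n. Proof. by lia. Qed.
Fact dbar_cod1 : k.-1 + 2 + (n - k) = n.+1. Proof. by lia. Qed.
Fact dbar_dom2 : k + 0 + (n - k) = n. Proof. by lia. Qed.
Fact dbar_cod2 : k + 1 + (n - k) = n.+1. Proof. by lia. Qed.
Fact dbar_dom3 : k.-1 + 0 + (n - k + 1) = n. Proof. by lia. Qed.
Fact dbar_cod3 : k.-1 + 1 + (n - k + 1) = n.+1. Proof. by lia. Qed.

End DeltaBarTypes.

Local Open Scope ring_scope.

Section LawvereMonads.
Variable K : comPzRingType.

Section AssociatedMonad.
Variable C : lawvere.

Definition lmon_hom (m n : nat) : lmodType K := freemod K (C n m).
Definition lmon_comp p m n (g : lmon_hom p m) (f : lmon_hom m n) : lmon_hom p n :=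
  linext (fun b : C m p => linext (fun a : C n m => fm_basis K (lcomp b a)) f) g.

Lemma lmon_compE p m n (b : C m p) (a : C n m) :
  lmon_comp (fm_basis K b) (fm_basis K a) = fm_basis K (lcomp b a).
Proof. by rewrite /lmon_comp !linext_basis. Qed.

Fact lmon_linearl p m n (f : lmon_hom m n) :
  linear (fun g : lmon_hom p m => lmon_comp g f).
Proof. exact: linext_linear. Qed.

Fact lmon_linearr p m n (g : lmon_hom p m) : linear (@lmon_comp p m n g).
Proof.
move=> a u v; rewrite /lmon_comp /linext scaler_sumr -big_split.
apply: eq_bigr => b _ /=; rewrite -!/(linext _ _) linext_linear scalerDr.
by rewrite !scalerA mulrC.
Qed.

Fact lmon_compA q p m n (h : lmon_hom q p) (g : lmon_hom p m) (f : lmon_hom m n) :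
  lmon_comp h (lmon_comp g f) = lmon_comp (lmon_comp h g) f.
Proof.
move: h; apply: fm_linear_ext => [a u v|a u v|c]; rewrite ?lmon_linearl //.
move: g; apply: fm_linear_ext => [a u v|a u v|b]; rewrite ?lmon_linearl ?lmon_linearr ?lmon_linearl //.
move: f; apply: fm_linear_ext => [a u v|a u v|a]; rewrite ?lmon_linearr //.
by rewrite !lmon_compE lcompA.
Qed.

Definition lmon_one n : lmon_hom n n := fm_basis K (lid C n).

Fact lmon_comp1m m n (f : lmon_hom m n) : lmon_comp (lmon_one m) f = f.
Proof.
move: f; apply: fm_linear_ext => [|a u v|a] //; first exact: lmon_linearr.
by rewrite lmon_compE lcomp1f.
Qed.

Fact lmon_compm1 m n (f : lmon_hom m n) : lmon_comp f (lmon_one n) = f.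
Proof.
move: f; apply: fm_linear_ext => [|a u v|a] //; first exact: lmon_linearl.
by rewrite lmon_compE lcompf1.
Qed.

Definition lmonad : monad K nat :=
  Monad lmon_linearl lmon_linearr lmon_compA lmon_comp1m lmon_compm1.

End AssociatedMonad.

Section AssociatedMorphism.
Variables (C D : lawvere) (F : lfunctor C D).

Definition lmmap (m n : nat) : {linear lmonad C m n -> lmonad D m n} :=
  linext (fun a : C n m => fm_basis K (F n m a)).

Fact lmmap_comp p m n (g : lmonad C p m) (f : lmonad C m n) :
  lmmap p n (mcomp g f) = mcomp (lmmap p m g) (lmmap m n f).
Proof.
move: g; apply: fm_linear_ext => [a u v|a u v|b].
- by rewrite mcomp_linearl linearP.
- by rewrite linearP mcomp_linearl.
move: f; apply: fm_linear_ext => [a u v|a u v|a].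
- by rewrite mcomp_linearr linearP.
- by rewrite linearP mcomp_linearr.
by rewrite /= lmon_compE !linext_basis lmon_compE lf_comp.
Qed.

Fact lmmap_one n : lmmap n n (mone (lmonad C) n) = mone (lmonad D) n.
Proof. by rewrite /= linext_basis lf_id. Qed.

Definition lmonad_map : monad_mor (lmonad C) (lmonad D) :=
  MonadMor lmmap_comp lmmap_one.

End AssociatedMorphism.

Section PrimitiveIdeal.
Variable C : zlawvere.

Definition delta_bar n k (hk : (0 < k <= n)%N) : lmonad C n.+1 n :=
  let idD := lprod (lprod (lid C k.-1) (ldiag C)) (lid C (n - k)) in
  let idk := lprod (lprod (lid C k) (lzero C 1)) (lid C (n - k)) in
  let idk1 := lprod (lprod (lid C k.-1) (lzero C 1)) (lid C (n - k + 1)) in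
  fm_basis K (hom_cast C (dbar_dom1 hk) (dbar_cod1 hk) idD)
  - fm_basis K (hom_cast C (dbar_dom2 hk) (dbar_cod2 hk) idk)
  - fm_basis K (hom_cast C (dbar_dom3 hk) (dbar_cod3 hk) idk1).

Variant is_delta_bar : forall m n, lmonad C m n -> Prop :=
  IsDeltaBar n k (hk : (0 < k <= n)%N) : is_delta_bar (delta_bar hk).

Definition Ipr : lideal (lmonad C) := lideal_gen is_delta_bar.
Definition Phi : monad K nat := eigenmonad Ipr.

End PrimitiveIdeal.
End LawvereMonads.

(* Monoid morphisms between groups are the group morphisms, so the same        *)
(* construction applies to free monoids and to free groups.                    *)
Notation mhomType G H := (UMagmaMorphism.type G H).

Lemma mhom_ext (G H : monoidType) (f g : mhomType G H) : f =1 g -> f = g.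
Proof.
case: f g => f [[f1] [fM]] [g [[g1] [gM]]] /= /funext fg; subst g.
by rewrite (Prop_irrelevance f1 g1) (Prop_irrelevance fM gM).
Qed.

Definition mk_mhom (G H : monoidType) (f : G -> H) (fP : monoid.monoid_morphism f) :
  mhomType G H := HB.pack f (isUMagmaMorphism.Build G H f fP).

Fact mhom_id_subproof (G : monoidType) : monoid.monoid_morphism (@idfun G).
Proof. by []. Qed.
Definition mhom_id (G : monoidType) : mhomType G G := mk_mhom (@mhom_id_subproof G).

Fact mhom_comp_subproof (G H L : monoidType) (g : mhomType H L) (f : mhomType G H) :
  monoid.monoid_morphism (g \o f).
Proof. by split=> [|x y] /=; rewrite ?gmulf1 ?gmulfM. Qed.
Definition mhom_comp (G H L : monoidType) (g : mhomType H L) (f : mhomType G H) :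
  mhomType G L := mk_mhom (mhom_comp_subproof g f).

(* Objects indexed by nat, with fa_obj n freely generated by n elements        *)
(* relatively to the other members of the family.                              *)
Record free_family := FreeFamily {
  fa_obj :> nat -> monoidType;
  fa_gen : forall n, 'I_n -> fa_obj n;
  fa_lift : forall m n, ('I_m -> fa_obj n) -> mhomType (fa_obj m) (fa_obj n);
  fa_lift_gen : forall m n (g : 'I_m -> fa_obj n) i, fa_lift g (fa_gen i) = g i;
  fa_ext : forall m n (f g : mhomType (fa_obj m) (fa_obj n)),
    (forall i, f (fa_gen i) = g (fa_gen i)) -> f = g
}.

Section OppositeTheory.
Variable A : free_family.

(* fhom n m is the set of morphisms from n to m in the opposite category.      *)
Definition fhom (n m : nat) : choiceType := {classic mhomType (A m) (A n)}.
Definition fcomp l m n (g : fhom m n) (f : fhom l m) : fhom l n := mhom_comp f g.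
Definition fid n : fhom n n := mhom_id (A n).
Definition fterm n : fhom n 0 := fa_lift (fun i : 'I_0 => fa_gen A (widen_ord (leq0n n) i)).
Definition ffst m n : fhom (m + n) m := fa_lift (fun i => fa_gen A (lshift n i)).
Definition fsnd m n : fhom (m + n) n := fa_lift (fun i => fa_gen A (rshift m i)).
Definition fpair l m n (f : fhom l m) (g : fhom l n) : fhom l (m + n) :=
  fa_lift (fun i => match split i with
                    | inl j => (f : mhomType (A m) (A l)) (fa_gen A j)
                    | inr j => (g : mhomType (A n) (A l)) (fa_gen A j)
                    end).

Definition fgenv m n (f : fhom n m) (i : 'I_m) : A n :=
  (f : mhomType (A m) (A n)) (fa_gen A i).

Lemma fhomP m n (f g : fhom n m) : fgenv f =1 fgenv g -> f = g.
Proof. exact: fa_ext. Qed.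

Lemma fgenv_lift m n (g : 'I_m -> A n) i : fgenv (fa_lift g : fhom n m) i = g i.
Proof. exact: fa_lift_gen. Qed.

Lemma fgenv_comp l m n (g : fhom m n) (f : fhom l m) i :
  fgenv (fcomp g f) i = (f : mhomType (A m) (A l)) (fgenv g i).
Proof. by []. Qed.

Lemma fgenv_cast m n n' (e : n = n') (f : fhom n m) i j :
  fgenv f i = fa_gen A j ->
  fgenv (hom_cast fhom e (erefl m) f) i = fa_gen A (cast_ord e j).
Proof. by case: _ / e; rewrite cast_ord_id. Qed.

Fact fcompA k l m n (h : fhom m n) (g : fhom l m) (f : fhom k l) :
  fcomp h (fcomp g f) = fcomp (fcomp h g) f.
Proof. exact: mhom_ext. Qed.
Fact fcomp1f m n (f : fhom m n) : fcomp (fid n) f = f.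
Proof. exact: mhom_ext. Qed.
Fact fcompf1 m n (f : fhom m n) : fcomp f (fid m) = f.
Proof. exact: mhom_ext. Qed.
Fact fterm_uniq n (f : fhom n 0) : f = fterm n.
Proof. by apply: fhomP => -[]. Qed.
Fact ffst_pair l m n (f : fhom l m) (g : fhom l n) : fcomp (ffst m n) (fpair f g) = f.
Proof.
by apply: fhomP => i; rewrite fgenv_comp fgenv_lift fa_lift_gen (unsplitK (inl i)).
Qed.
Fact fsnd_pair l m n (f : fhom l m) (g : fhom l n) : fcomp (fsnd m n) (fpair f g) = g.
Proof.
by apply: fhomP => i; rewrite fgenv_comp fgenv_lift fa_lift_gen (unsplitK (inr i)).
Qed.
Fact fpair_uniq l m n (h : fhom l (m + n)) :
  h = fpair (fcomp (ffst m n) h) (fcomp (fsnd m n) h).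
Proof.
apply: fhomP => i; rewrite fgenv_lift -{1}(splitK i).
by case: (split i) => j /=; rewrite fa_lift_gen.
Qed.
Fact ffst0 n : hom_cast fhom (addn0 n) (erefl n) (ffst n 0) = fid n.
Proof.
apply: fhomP => i; rewrite (fgenv_cast _ (j := lshift 0 i)) ?fgenv_lift //.
by congr fa_gen; apply: val_inj.
Qed.
Fact fsnd0 n : fsnd 0 n = fid n.
Proof.
by apply: fhomP => i; rewrite fgenv_lift; congr fa_gen; apply: val_inj.
Qed.
Fact fassoc1 m n p : hom_cast fhom (addnA m n p) (erefl m) (ffst m (n + p)) =
  fcomp (ffst m n) (ffst (m + n) p).
Proof.
apply: fhomP => i; rewrite (fgenv_cast _ (j := lshift _ i)) ?fgenv_lift //.
by rewrite fgenv_comp fgenv_lift fa_lift_gen; congr fa_gen; apply: val_inj.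
Qed.
Fact fassoc2 m n p :
  hom_cast fhom (addnA m n p) (erefl n) (fcomp (ffst n p) (fsnd m (n + p))) =
  fcomp (fsnd m n) (ffst (m + n) p).
Proof.
apply: fhomP => i; rewrite (fgenv_cast _ (j := rshift m (lshift p i))).
  by rewrite fgenv_comp fgenv_lift fa_lift_gen; congr fa_gen; apply: val_inj.
by rewrite fgenv_comp fgenv_lift fa_lift_gen.
Qed.
Fact fassoc3 m n p :
  hom_cast fhom (addnA m n p) (erefl p) (fcomp (fsnd n p) (fsnd m (n + p))) = fsnd (m + n) p.
Proof.
apply: fhomP => i; rewrite (fgenv_cast _ (j := rshift m (rshift n i))).
  by rewrite fgenv_lift; congr fa_gen; apply: val_inj; rewrite /= addnA.
by rewrite fgenv_comp fgenv_lift fa_lift_gen.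
Qed.

Definition op_lawvere : lawvere :=
  Lawvere fcompA fcomp1f fcompf1 fterm_uniq ffst_pair fsnd_pair fpair_uniq
    ffst0 fsnd0 fassoc1 fassoc2 fassoc3.

Fact fone_subproof (G H : monoidType) : monoid.monoid_morphism (fun _ : G => 1%g : H).
Proof. by split=> // x y; rewrite mulg1. Qed.
Definition fzero n : fhom 0 n := mk_mhom (@fone_subproof (A n) (A 0)).

Lemma fa_obj0 (x : A 0) : x = 1%g.
Proof.
have e : mhom_id (A 0) = mk_mhom (@fone_subproof (A 0) (A 0)).
  by apply: fa_ext => -[].
by rewrite -[LHS]/(mhom_id _ x) e.
Qed.

Fact fzero_uniq n (f : fhom 0 n) : f = fzero n.
Proof. by apply: fhomP => i; rewrite [LHS]fa_obj0. Qed.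

Definition op_theory : zlawvere := @ZLawvere op_lawvere fzero fzero_uniq.

End OppositeTheory.

Definition free_monoid (n : nat) : Type := seq 'I_n.
HB.instance Definition _ n := Choice.on (free_monoid n).
HB.instance Definition _ n := isMonoid.Build (free_monoid n)
  (@catA 'I_n) (@cat0s 'I_n) (@cats0 'I_n).

Section FreeMonoid.

Definition fw_gen n (i : 'I_n) : free_monoid n := [:: i].

Definition fw_eval (G : monoidType) m (g : 'I_m -> G) (w : free_monoid m) : G :=
  (\prod_(i <- (w : seq 'I_m)) g i)%g.

Fact fw_eval_morph (G : monoidType) m (g : 'I_m -> G) : monoid.monoid_morphism (fw_eval g).
Proof. by split=> [|u v]; rewrite /fw_eval ?big_nil // big_cat. Qed.

Definition fw_lift (G : monoidType) m (g : 'I_m -> G) : mhomType (free_monoid m) G :=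
  mk_mhom (fw_eval_morph g).

Lemma fw_lift_gen (G : monoidType) m (g : 'I_m -> G) i : fw_lift g (fw_gen i) = g i.
Proof. by rewrite /= /fw_eval big_seq1. Qed.

Lemma fw_hom_ext (G : monoidType) m (f g : mhomType (free_monoid m) G) :
  (forall i, f (fw_gen i) = g (fw_gen i)) -> f = g.
Proof.
move=> fg; apply: mhom_ext; elim=> [|i w IHw]; first by rewrite !gmulf1.
by rewrite -[i :: w]/(fw_gen i * w)%g !gmulfM fg IHw.
Qed.

Definition monoid_family : free_family :=
  FreeFamily (fun m n => @fw_lift_gen (free_monoid n) m)
             (fun m n => @fw_hom_ext (free_monoid n) m).

End FreeMonoid.

(* The free group is modelled by reduced words; (i, true) stands for x_i and   *)
(* (i, false) for its inverse.                                                 *)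
Section ReducedWords.
Variable n : nat.
Notation letter := ('I_n * bool)%type.
Implicit Types (x y : letter) (u v w : seq letter).

Definition linv x : letter := (x.1, ~~ x.2).
Definition noncancel : rel letter := fun x y => y != linv x.
Definition reduced w := sorted noncancel w.

Definition rpush x w : seq letter :=
  if w is y :: w' then if y == linv x then w' else x :: w else [:: x].
Definition reduce w := foldr rpush [::] w.

Lemma linvK : involutive linv.
Proof. by case=> i b; rewrite /linv /= negbK. Qed.

Lemma reduced_rpush x w : reduced w -> reduced (rpush x w).
Proof.
case: w => [|y w] //= rw; case: eqP => [_|/eqP nxy].
  by apply: path_sorted rw.
by rewrite /reduced /= /noncancel nxy.
Qed.

Lemma rpush_reduced x w : reduced (x :: w) -> rpush x w = x :: w.
Proof. by case: w => [|y w] //= /andP[/negPf->]. Qed.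

Lemma rpushK x w : reduced w -> rpush x (rpush (linv x) w) = w.
Proof.
case: w => [|y w] /=; first by rewrite eqxx.
rewrite linvK; case: eqP => [->|_] rw; last by rewrite /= eqxx.
exact: rpush_reduced.
Qed.

Lemma reduced_act u w : reduced w -> reduced (foldr rpush w u).
Proof. by move=> rw; elim: u => //= x u; apply: reduced_rpush. Qed.

Lemma reduced_reduce w : reduced (reduce w).
Proof. exact: reduced_act. Qed.

Lemma reduce_id w : reduced w -> reduce w = w.
Proof.
elim: w => //= x w IHw rw.
by rewrite IHw ?rpush_reduced //; apply: path_sorted rw.
Qed.

Lemma reduce_cat u v : reduce (u ++ v) = foldr rpush (reduce v) u.
Proof. exact: foldr_cat. Qed.

Lemma act_rpush x w v : reduced v ->
  foldr rpush v (rpush x w) = rpush x (foldr rpush v w).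
Proof.
move=> rv; case: w => [|y w] //=; case: eqP => [->|//].
by rewrite rpushK ?reduced_act.
Qed.

Lemma act_reduce u v : reduced v -> foldr rpush v (reduce u) = foldr rpush v u.
Proof. by move=> rv; elim: u => //= x u IHu; rewrite act_rpush ?IHu. Qed.

Lemma reduce_catl u v : reduce (reduce u ++ v) = reduce (u ++ v).
Proof. by rewrite !reduce_cat act_reduce ?reduced_reduce. Qed.

Lemma reduce_catr u v : reduce (u ++ reduce v) = reduce (u ++ v).
Proof. by rewrite !reduce_cat reduce_id ?reduced_reduce. Qed.

Definition winv w := rev (map linv w).

Lemma winvK : involutive winv.
Proof. by move=> w; rewrite /winv map_rev revK -map_comp (eq_map linvK) map_id. Qed.

Lemma reduce_winvl w : reduce (winv w ++ w) = [::].
Proof.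
elim: w => //= x w IHw; rewrite /winv /= rev_cons cat_rcons.
rewrite reduce_cat /=.
have := rpushK (linv x) (reduced_reduce w); rewrite linvK => ->.
by rewrite -reduce_cat.
Qed.

End ReducedWords.

Definition free_group (n : nat) : Type := {w : seq ('I_n * bool) | reduced w}.
HB.instance Definition _ n := SubChoice.on (free_group n).

Section FreeGroup.
Variable n : nat.

Definition fg_mk (w : seq ('I_n * bool)) : free_group n :=
  exist _ (reduce w) (reduced_reduce w).
Definition fg_one : free_group n := fg_mk [::].
Definition fg_mul (u v : free_group n) : free_group n := fg_mk (val u ++ val v).
Definition fg_inv (u : free_group n) : free_group n := fg_mk (winv (val u)).

Lemma val_fg_mk w : val (fg_mk w) = reduce w. Proof. by []. Qed.

Lemma fg_mk_val (u : free_group n) : fg_mk (val u) = u.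
Proof. by apply: val_inj; rewrite val_fg_mk reduce_id //; apply: (valP u). Qed.

Fact fg_mulA : associative fg_mul.
Proof.
by move=> u v w; apply: val_inj; rewrite !val_fg_mk reduce_catl reduce_catr catA.
Qed.
Fact fg_mul1 : left_id fg_one fg_mul.
Proof. exact: fg_mk_val. Qed.
Fact fg_mulr1 : right_id fg_one fg_mul.
Proof. by move=> u; rewrite /fg_mul cats0 fg_mk_val. Qed.
Fact fg_mulV : left_inverse fg_one fg_inv fg_mul.
Proof. by move=> u; apply: val_inj; rewrite !val_fg_mk reduce_catl reduce_winvl. Qed.
Fact fg_mulrV : right_inverse fg_one fg_inv fg_mul.
Proof.
move=> u; apply: val_inj; rewrite !val_fg_mk reduce_catr.
by rewrite -{1}(winvK (val u)) reduce_winvl.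
Qed.

HB.instance Definition _ := isGroup.Build (free_group n)
  fg_mulA fg_mul1 fg_mulr1 fg_mulV fg_mulrV.

Definition fg_gen (i : 'I_n) : free_group n := fg_mk [:: (i, true)].

Definition fg_letter (G : groupType) (g : 'I_n -> G) (x : 'I_n * bool) : G :=
  if x.2 then g x.1 else (g x.1)^-1%g.

Definition fg_eval (G : groupType) (g : 'I_n -> G) (u : free_group n) : G :=
  (\prod_(x <- val u) fg_letter g x)%g.

Lemma prod_reduce (G : groupType) (g : 'I_n -> G) w :
  (\prod_(x <- reduce w) fg_letter g x = \prod_(x <- w) fg_letter g x)%g.
Proof.
elim: w => //= x w IHw; rewrite big_cons -{}IHw.
case: (reduce w) => [|y v] /=; first by rewrite big_cons.
case: eqP => [->|_]; last by rewrite !big_cons.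
rewrite big_cons mulgA /fg_letter /=.
by case: x.2; rewrite ?mulgV ?mulVg mul1g.
Qed.

Fact fg_eval_morph (G : groupType) (g : 'I_n -> G) : monoid.monoid_morphism (fg_eval g).
Proof.
by split=> [|u v]; rewrite /fg_eval ?big_nil // val_fg_mk prod_reduce big_cat.
Qed.

Definition fg_lift (G : groupType) (g : 'I_n -> G) : mhomType (free_group n) G :=
  mk_mhom (fg_eval_morph g).

Lemma fg_lift_gen (G : groupType) (g : 'I_n -> G) i : fg_lift g (fg_gen i) = g i.
Proof. by rewrite /= /fg_eval big_seq1. Qed.

Lemma fg_mk_cons x w : fg_mk (x :: w) = (fg_letter fg_gen x * fg_mk w)%g.
Proof.
have -> : fg_letter fg_gen x = fg_mk [:: x] by case: x => i [].
by apply: val_inj; rewrite !val_fg_mk reduce_catl reduce_catr.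
Qed.

Lemma fg_hom_ext (G : groupType) (f g : mhomType (free_group n) G) :
  (forall i, f (fg_gen i) = g (fg_gen i)) -> f = g.
Proof.
move=> fg; apply: mhom_ext => u; rewrite -[u]fg_mk_val.
elim: (val u) => [|x w IHw]; first by rewrite -/fg_one !gmulf1.
rewrite fg_mk_cons !gmulfM IHw; congr (_ * _)%g.
by rewrite /fg_letter; case: x.2; rewrite ?gmulfV fg.
Qed.

End FreeGroup.

Definition group_family : free_family :=
  @FreeFamily (fun n => free_group n) fg_gen
    (fun m n => @fg_lift m (free_group n))
    (fun m n => @fg_lift_gen m (free_group n))
    (fun m n => @fg_hom_ext m (free_group n)).

Definition Wop : zlawvere := op_theory monoid_family.
Definition Fop : zlawvere := op_theory group_family.

Definition WtoF n : mhomType (free_monoid n) (free_group n) := fw_lift (@fg_gen n).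

Definition groupify m n (f : mhomType (free_monoid m) (free_monoid n)) :
    mhomType (free_group m) (free_group n) :=
  fg_lift (fun i => WtoF n (f (fw_gen i))).

Lemma groupify_WtoF m n (f : mhomType (free_monoid m) (free_monoid n)) w :
  groupify f (WtoF m w) = WtoF n (f w).
Proof.
have e : mhom_comp (groupify f) (WtoF m) = mhom_comp (WtoF n) f.
  by apply: fw_hom_ext => i /=; rewrite [fw_eval _ _]fw_lift_gen [LHS]fg_lift_gen.
by rewrite -[LHS]/(mhom_comp (groupify f) (WtoF m) w) e.
Qed.

Lemma WtoF_inj n : injective (WtoF n).
Proof.
have redT (s : seq 'I_n) : reduced [seq (i, true) | i <- s].
  case: s => // i s; rewrite /reduced /=; elim: s i => // j s IHs i /=.
  by rewrite IHs andbT /noncancel xpair_eqE andbF.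
have valE (w : free_monoid n) : val (WtoF n w) = [seq (i, true) | i <- w].
  elim: w => [|i w IHw]; first by rewrite gmulf1.
  rewrite -[i :: w]/(fw_gen i * w)%g gmulfM [WtoF n (fw_gen i)]fw_lift_gen.
  by rewrite val_fg_mk IHw; apply: reduce_id; apply: (redT (i :: w)).
by move=> u v /(congr1 val); rewrite !valE; apply: inj_map => i j [].
Qed.

Definition groupify_op m n (f : Wop m n) : Fop m n :=
  groupify (f : mhomType (free_monoid n) (free_monoid m)).

Fact groupify_id n : groupify_op (lid Wop n) = lid Fop n.
Proof.
by apply: fg_hom_ext => i; rewrite [LHS]fg_lift_gen [LHS]fw_lift_gen.
Qed.

Fact groupify_comp l m n (g : Wop m n) (f : Wop l m) :
  groupify_op (lcomp g f) = lcomp (groupify_op g) (groupify_op f).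
Proof.
apply: fg_hom_ext => i; rewrite [LHS]fg_lift_gen.
rewrite -[RHS]/(groupify f (groupify g (fg_gen i))).
by rewrite [groupify g _]fg_lift_gen groupify_WtoF.
Qed.

Definition groupification : lfunctor Wop Fop :=
  LFunctor groupify_id groupify_comp.

(* Main.v *)
Require Import Defs.
From mathcomp Require Import all_boot all_algebra.
From HB Require Import structures.
From mathcomp Require Import finmap boolp zify.

(** Write J_W and J_F for the two ideals of primitive elements, and h for the
    monad map induced by groupification.  Everything follows once h maps J_W
    into J_F and Iz(J_W) into Iz(J_F), J_W is the whole preimage of J_F, and
    L_F = h(L_W) + J_F.  The first two hold because h sends the generators of
    J_W to those of J_F.

    Modulo the ideal, a tuple of words in which an occurrence of x_k^(+-1) is
    singled out is the sum of the tuple with that occurrence deleted and of the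
    tuple with all other occurrences of x_k deleted; a tuple without x_k
    vanishes, and a lone x_k^-1 may be replaced by x_k at the cost of a sign.
    This gives the surjectivity statement, by induction on the number of
    negative letters, and shows that L_W / J_W is spanned by the tuples of words
    in which every letter occurs exactly once.  For each such tuple, a product
    of coefficients of the Magnus expansion is a functional on L_F that vanishes
    on J_F; these functionals separate the spanning tuples, whence
    injectivity. *)

Set Implicit Arguments.
Unset Strict Implicit.
Unset Printing Implicit Defensive.

Import GRing.Theory.
Local Open Scope ring_scope.

(** * Bijective morphisms of monads and of bimodules *)

Section BijectiveMorphisms.
Variable K : comPzRingType.

(** The pointwise inverse, obtained by choice, inherits linearity and compatibility with composition
    and units from [h], because [h] is injective. *)
Lemma monad_iso_bij (X : Type) (T S : monad K X) (h : monad_mor T S) :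
  (forall Y W, injective (h Y W)) -> (forall Y W s, exists t, h Y W t = s) ->
  monad_iso h.
Proof.
move=> hI hS; pose g Y W s := sval (cid (hS Y W s)).
have gK Y W : cancel (g Y W) (h Y W) by move=> s; exact: (svalP (cid (hS Y W s))).
have gl Y W : linear (g Y W).
  by move=> a u v; apply: (hI); rewrite linearP !gK.
pose G Y W : {linear S Y W -> T Y W} :=
  HB.pack (g Y W) (GRing.isLinear.Build K _ _ _ (g Y W) (gl Y W)).
have GM Z Y W (s : S Z Y) (t : S Y W) : G Z W (mcomp s t) = mcomp (G Z Y s) (G Y W t).
  by apply: (hI); rewrite mmor_comp /= !gK.
have G1 Y : G Y Y (mone S Y) = mone T Y.
  by apply: (hI); rewrite mmor_one /= gK.
by exists (MonadMor GM G1) => Y W; split=> [t|]; [apply: hI; rewrite /= gK | apply: gK].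
Qed.

Lemma bimod_iso_bij (X Y : Type) (T : monad K X) (S : monad K Y) (B C : bimod T S)
    (h : bimod_mor B C) :
  (forall x y, injective (h x y)) -> (forall x y c, exists b, h x y b = c) ->
  bimod_iso h.
Proof.
move=> hI hS; pose g x y c := sval (cid (hS x y c)).
have gK x y : cancel (g x y) (h x y) by move=> c; exact: (svalP (cid (hS x y c))).
have gl x y : linear (g x y).
  by move=> a u v; apply: (hI); rewrite linearP !gK.
pose G x y : {linear C x y -> B x y} :=
  HB.pack (g x y) (GRing.isLinear.Build K _ _ _ (g x y) (gl x y)).
have Gl x' x y (t : T x' x) (c : C x y) : G x' y (lact t c) = lact t (G x y c).
  by apply: (hI); rewrite bmor_lact /= !gK.
have Gr x y y' (c : C x y) (s : S y y') : G x y' (ract c s) = ract (G x y c) s.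
  by apply: (hI); rewrite bmor_ract /= !gK.
by exists (BimodMor Gl Gr) => x y; split=> [b|]; [apply: hI; rewrite /= gK | apply: gK].
Qed.

End BijectiveMorphisms.

(** * Maps induced on eigenmonads and canonical bimodules *)

Section InducedIsomorphisms.
Variables (K : comPzRingType) (X : Type) (T S : monad K X).
Variables (J : lideal T) (J' : lideal S) (h : monad_mor T S).
Hypothesis hJ : forall Y W f, J Y W f <-> J' Y W (h Y W f).
Hypothesis hIz : forall Y W f, Iz J Y W f -> Iz J' Y W (h Y W f).
Hypothesis hS : forall Y W (s : S Y W), exists t, J' Y W (s - h Y W t).

Definition sub_map Y W (f : sub_mod (Iz J Y W)) : sub_mod (Iz J' Y W) :=
  mk_sub (hIz (sub_modP f)).

Definition phi_fun Y W (q : eigenmonad J Y W) : eigenmonad J' Y W :=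
  eproj (sub_map (qrepr q)).

Lemma phi_funE Y W (f : sub_mod (Iz J Y W)) : phi_fun (eproj f) = eproj (sub_map f).
Proof.
apply/qprojP; rewrite /= /J_in_Iz_mem raddfB /= -raddfB; apply/hJ.
by have /qprojP := qreprK (eproj f); rewrite /= /J_in_Iz_mem raddfB.
Qed.

Fact phi_linear Y W : linear (@phi_fun Y W).
Proof.
move=> a; elim/eprojW=> f; elim/eprojW=> g.
rewrite -eprojP !phi_funE -eprojP; congr eproj; apply: val_inj.
by rewrite sub_valP /= linearP.
Qed.

Definition phi_lin Y W : {linear eigenmonad J Y W -> eigenmonad J' Y W} :=
  HB.pack (@phi_fun Y W) (GRing.isLinear.Build K _ _ _ _ (@phi_linear Y W)).

Fact phi_comp Z Y W (g : eigenmonad J Z Y) (f : eigenmonad J Y W) :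
  phi_lin Z W (mcomp g f) = mcomp (phi_lin Z Y g) (phi_lin Y W f).
Proof.
elim/eprojW: g => g; elim/eprojW: f => f; rewrite /= ecompE !phi_funE ecompE.
by congr eproj; apply: val_inj; rewrite /= mmor_comp.
Qed.

Fact phi_one Y : phi_lin Y Y (mone (eigenmonad J) Y) = mone (eigenmonad J') Y.
Proof.
by rewrite /= phi_funE; congr eproj; apply: val_inj; rewrite /= mmor_one.
Qed.

Definition phi_mor := MonadMor phi_comp phi_one.

Definition psi_fun Y W (q : canon_bimod J Y W) : canon_bimod J' Y W :=
  cproj J' (h Y W (qrepr q)).

Lemma psi_funE Y W (f : T Y W) : psi_fun (cproj J f) = cproj J' (h Y W f).
Proof. by apply/qprojP; rewrite -raddfB; apply/hJ/qprojP/qreprK. Qed.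

Fact psi_linear Y W : linear (@psi_fun Y W).
Proof.
move=> a; elim/cprojW=> f; elim/cprojW=> g.
by rewrite -cprojP !psi_funE -cprojP linearP.
Qed.

Definition psi_lin Y W :
    {linear canon_bimod J Y W -> bimod_restr h phi_mor (canon_bimod J') Y W} :=
  HB.pack (@psi_fun Y W) (GRing.isLinear.Build K _ _ _ _ (@psi_linear Y W)).

Fact psi_lact Z Y W (t : T Z Y) (b : canon_bimod J Y W) :
  psi_lin Z W (lact t b) = lact t (psi_lin Y W b).
Proof.
elim/cprojW: b => f.
by rewrite /= clactE !psi_funE /restr_lact /= clactE mmor_comp.
Qed.

Fact psi_ract Z Y W (b : canon_bimod J Z Y) (s : eigenmonad J Y W) :
  psi_lin Z W (ract b s) = ract (psi_lin Z Y b) s.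
Proof.
elim/cprojW: b => g; elim/eprojW: s => f.
by rewrite /= cractE !psi_funE /restr_ract /= phi_funE cractE mmor_comp.
Qed.

Definition psi_mor := BimodMor psi_lact psi_ract.

(** Injectivity of both maps comes from [hJ] and surjectivity from [hS]; for the eigenmonads, the
    preimage given by [hS] must also be shown to lie in [Iz J]. *)
Lemma induced_isos :
  exists (phi : monad_mor (eigenmonad J) (eigenmonad J'))
         (psi : bimod_mor (canon_bimod J) (bimod_restr h phi (canon_bimod J'))),
    [/\ induces_eigen h phi, induces_canon psi, monad_iso phi & bimod_iso psi].
Proof.
exists phi_mor, psi_mor; split.
- by move=> Y W f; exists (sub_map f); split; rewrite //= phi_funE.
- by move=> Y W f; rewrite /= psi_funE.
- apply: monad_iso_bij => Y W.
    elim/eprojW=> f; elim/eprojW=> g; rewrite /= !phi_funE => /qprojP.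
    rewrite /= /J_in_Iz_mem raddfB /= -raddfB => /hJ fg.
    by apply/qprojP; rewrite /= /J_in_Iz_mem raddfB.
  elim/eprojW=> s; have [t Jst] := hS (val s).
  have Jts : J' Y W (h Y W t - val s) by rewrite -opprB -scaleN1r; apply: smodZ.
  (* j t lies in J because its image differs from (h j) s by an element of J'. *)
  have It : Iz J Y W t.
    move=> Z j Jj; apply/hJ; rewrite mmor_comp -[h Y W t](subrK (val s)).
    rewrite -[_ - _]scale1r mcomp_linearr; apply: smodP.
      exact: lideal_comp.
    by apply: (sub_modP s); apply/hJ.
  exists (eproj (mk_sub It)); rewrite /= phi_funE; apply/qprojP.
  by rewrite /= /J_in_Iz_mem raddfB.
- apply: bimod_iso_bij => Y W.
    elim/cprojW=> f; elim/cprojW=> g; rewrite /= !psi_funE => /qprojP.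
    by rewrite -raddfB => /hJ fg; apply/qprojP.
  elim/cprojW=> s; have [t Jst] := hS s.
  exists (cproj J t); rewrite /= psi_funE; apply/qprojP.
  by rewrite -opprB -scaleN1r; apply: smodZ.
Qed.

End InducedIsomorphisms.

(** * The generators of the ideal as renamings of letters *)

(** These are the three terms of a generator. Of the n+1 letters, [k] (the left one) and [k+1] (the
    right one) form a pair. [split0] merges the pair into [k], [split1] deletes the right letter and
    [split2] the left one; [None] stands for deletion. *)
Definition split0 n (k : 'I_n) (j : 'I_n.+1) : option 'I_n :=
  Some (odflt k (unlift (lift ord0 k) j)).
Definition split1 n (k : 'I_n) (j : 'I_n.+1) : option 'I_n :=
  unlift (lift ord0 k) j.
Definition split2 n (k : 'I_n) (j : 'I_n.+1) : option 'I_n :=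
  unlift (widen_ord (leqnSn n) k) j.

Section Renamings.
Variable A : free_family.

(** Identities, diagonals and zero morphisms all have this form, which is stable under products and
    transports; equalities between them reduce to arithmetic on indices. *)
Definition ren m n (t : 'I_m -> option 'I_n) : op_theory A n m :=
  fa_lift (fun j => oapp (@fa_gen A n) 1%g (t j)) : fhom A n m.

Lemma eq_ren m n (t u : 'I_m -> option 'I_n) : t =1 u -> ren t = ren u.
Proof. by move=> tu; congr fa_lift; apply/funext => j; rewrite tu. Qed.

Lemma renP m n (t : 'I_m -> option 'I_n) (f : fhom A n m) :
  (forall j, fgenv f j = oapp (@fa_gen A n) 1%g (t j)) -> f = ren t.
Proof. by move=> ft; apply: fhomP => j; rewrite ft fgenv_lift. Qed.

Lemma fgenv_ren m n (t : 'I_m -> option 'I_n) j :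
  fgenv (ren t : fhom A n m) j = oapp (@fa_gen A n) 1%g (t j).
Proof. exact: fgenv_lift. Qed.

Lemma ren_id n : lid (op_theory A) n = ren (fun j => Some j).
Proof. exact: renP. Qed.

Lemma ren_zero n : lzero (op_theory A) n = ren (fun _ => None).
Proof. exact/esym/lzero_uniq. Qed.

Lemma ren_prod m n m' n' (t : 'I_n -> option 'I_m) (u : 'I_n' -> option 'I_m') :
  lprod (ren t) (ren u) =
  ren (fun j => match split j with
                | inl i => omap (@lshift m m') (t i)
                | inr i => omap (@rshift m m') (u i)
                end).
Proof.
apply: renP => j; rewrite [LHS]fgenv_lift; case: (split j) => i.
  rewrite -[LHS]/(fgenv (fcomp (ren t) (ffst A m m')) i) fgenv_comp fgenv_ren.
  by case: (t i) => [a|] /=; rewrite ?gmulf1 // fa_lift_gen.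
rewrite -[LHS]/(fgenv (fcomp (ren u) (fsnd A m m')) i) fgenv_comp fgenv_ren.
by case: (u i) => [a|] /=; rewrite ?gmulf1 // fa_lift_gen.
Qed.

Lemma ren_diag : ldiag (op_theory A) = ren (fun _ => Some ord0).
Proof.
apply: renP => j; rewrite [LHS]fgenv_lift.
by case: (@split 1 1 j) => i; rewrite ord1.
Qed.

Lemma ren_cast m m' n n' (em : m = m') (en : n = n') (t : 'I_n -> option 'I_m) :
  hom_cast (op_theory A) em en (ren t) =
  ren (fun j => omap (cast_ord em) (t (cast_ord (esym en) j))).
Proof.
case: _ / em; case: _ / en; apply: eq_ren => j /=; rewrite cast_ord_id.
by case: (t j) => [i|] //=; rewrite cast_ord_id.
Qed.

Section DeltaBar.
Variables (n k : nat) (hk : (0 < k <= n)%N).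

Fact pred_ltn_subproof : (k.-1 < n)%N. Proof. by lia. Qed.
(** [delta_bar] numbers letters from 1, ordinals from 0. *)
Let i := Ordinal pred_ltn_subproof.

Let omap_val_inj (o o' : option 'I_n) : omap val o = omap val o' -> o = o'.
Proof. by apply: inj_omap; apply: val_inj. Qed.

Let omap_val_unlift (h j : 'I_n.+1) :
  omap val (unlift h j) = if j == h :> nat then None else Some (unbump h j).
Proof.
case: unliftP => [l ->|->] /=; last by rewrite eqxx.
by rewrite bumpK eq_sym (negPf (neq_bump _ _)).
Qed.

Let split0E : hom_cast (op_theory A) (dbar_dom1 hk) (dbar_cod1 hk)
    (lprod (lprod (lid (op_theory A) k.-1) (ldiag (op_theory A)))
           (lid (op_theory A) (n - k))) = ren (split0 i).
Proof.
rewrite !ren_id ren_diag !ren_prod ren_cast.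
apply: eq_ren => j; apply: omap_val_inj.
(* This brings the default value of [split0] down to integers, so that each block of the product can
   be settled by arithmetic. *)
have -> : omap val (split0 i j) =
    Some (odflt (val i) (omap val (unlift (lift ord0 i) j))).
  by rewrite /split0; case: unlift.
rewrite omap_val_unlift /= /unbump /bump /=.
case: splitP => j1 /= e1; first case: splitP => j2 /= e2; last first.
- by case: eqP => ?; congr Some => /=; lia.
- by have := ltn_ord j2; case: eqP => ? ?; congr Some; rewrite /= ?ord1 /=; lia.
- by have := ltn_ord j2; case: eqP => ? ?; congr Some => /=; lia.
Qed.

Let split1E : hom_cast (op_theory A) (dbar_dom2 hk) (dbar_cod2 hk)
    (lprod (lprod (lid (op_theory A) k) (lzero (op_theory A) 1))
           (lid (op_theory A) (n - k))) = ren (split1 i).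
Proof.
rewrite !ren_id ren_zero !ren_prod ren_cast.
apply: eq_ren => j; apply: omap_val_inj; rewrite omap_val_unlift /= /unbump /bump /=.
case: splitP => j1 /= e1; first case: splitP => j2 /= e2; last first.
- by case: eqP => ?; last congr Some => /=; lia.
- by have := ltn_ord j2; case: eqP => //=; lia.
- by have := ltn_ord j2; case: eqP => ? ?; last congr Some => /=; lia.
Qed.

Let split2E : hom_cast (op_theory A) (dbar_dom3 hk) (dbar_cod3 hk)
    (lprod (lprod (lid (op_theory A) k.-1) (lzero (op_theory A) 1))
           (lid (op_theory A) (n - k + 1))) = ren (split2 i).
Proof.
rewrite !ren_id ren_zero !ren_prod ren_cast.
apply: eq_ren => j; apply: omap_val_inj; rewrite omap_val_unlift /= /unbump /bump /=.
case: splitP => j1 /= e1; first case: splitP => j2 /= e2; last first.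
- by case: eqP => ?; last congr Some => /=; lia.
- by have := ltn_ord j2; case: eqP => //=; lia.
- by have := ltn_ord j2; case: eqP => ? ?; last congr Some => /=; lia.
Qed.

Lemma delta_barE (K : comPzRingType) : delta_bar K (op_theory A) hk =
    fm_basis K (ren (split0 i)) - fm_basis K (ren (split1 i))
    - fm_basis K (ren (split2 i)).
Proof. by rewrite /delta_bar split0E split1E split2E. Qed.

End DeltaBar.
End Renamings.

(** * Relations between tuples modulo the ideal, for any free family *)

Section PrimitiveRelations.
Variables (K : comPzRingType) (A : free_family).
Local Notation C := (op_theory A).
Local Notation I := (Ipr K C).

Definition split_rel n (k : 'I_n) : lmonad K C n.+1 n :=
  fm_basis K (ren A (split0 k)) - fm_basis K (ren A (split1 k))
  - fm_basis K (ren A (split2 k)).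

Lemma Ipr_split_rel n (k : 'I_n) : I n.+1 n (split_rel k).
Proof.
have hk : (0 < k.+1 <= n)%N by have := ltn_ord k.
have -> : split_rel k = delta_bar K C hk.
  rewrite delta_barE; set i := Ordinal _; have -> // : i = k by apply: val_inj.
by move=> J; apply.
Qed.

(** This serves as an induction principle: a property holds on the whole ideal as soon as it defines
    a left ideal and holds for the generators. *)
Lemma Ipr_min (J : lideal (lmonad K C)) :
  (forall n (k : 'I_n), J n.+1 n (split_rel k)) ->
  forall m n (f : lmonad K C m n), I m n f -> J m n f.
Proof.
move=> JG m n f If; apply: (If J) => _ _ _ [n' k hk].
by rewrite delta_barE; apply: JG.
Qed.

Definition act m n (t : 'I_m -> option 'I_n) : mhomType (A m) (A n) := ren A t.
Definition tup m n (v : 'I_m -> A n) : C n m := fa_lift v : fhom A n m.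

Lemma act_gen m n (t : 'I_m -> option 'I_n) j :
  act t (fa_gen A j) = oapp (@fa_gen A n) 1%g (t j).
Proof. exact: fa_lift_gen. Qed.

Lemma eq_act m n (t u : 'I_m -> option 'I_n) x : t =1 u -> act t x = act u x.
Proof. by move=> /funext->. Qed.

Lemma act_some n x : act (fun j : 'I_n => Some j) x = x.
Proof.
suff -> : act (fun j : 'I_n => Some j) = mhom_id (A n) by [].
by apply: fa_ext => j; rewrite act_gen.
Qed.

Lemma act_none m n x : act (fun _ : 'I_m => None : option 'I_n) x = 1%g.
Proof.
suff -> : act (fun _ : 'I_m => None : option 'I_n) =
    mk_mhom (@fone_subproof (A m) (A n)) by [].
by apply: fa_ext => j; rewrite act_gen.
Qed.

Lemma act_comp l m n (t : 'I_m -> option 'I_n) (u : 'I_l -> option 'I_m) x :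
  act t (act u x) = act (fun j => obind t (u j)) x.
Proof.
suff <- : mhom_comp (act t) (act u) = act (fun j => obind t (u j)) by [].
apply: fa_ext => j; rewrite -[LHS]/(act t (act u (fa_gen A j))) !act_gen.
by case: (u j) => [i|] /=; rewrite ?gmulf1 // act_gen.
Qed.

Lemma eq_tup m n (v w : 'I_m -> A n) : v =1 w -> tup v = tup w.
Proof. by move=> /funext->. Qed.

Lemma tup_ren l m n (v : 'I_l -> A m) (t : 'I_m -> option 'I_n) :
  lcomp (tup v) (ren A t) = tup (fun j => act t (v j)).
Proof. by apply: fhomP => j; rewrite fgenv_comp !fgenv_lift. Qed.

Lemma tup_surj m n (f : C n m) : exists v, f = tup v.
Proof. by exists (fgenv (f : fhom A n m)); apply: fhomP => j; rewrite fgenv_lift. Qed.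

Lemma comp_split_rel n (k : 'I_n) p (v : 'I_p -> A n.+1) :
  mcomp (fm_basis K (tup v) : lmonad K C _ _) (split_rel k) =
  fm_basis K (tup (fun j => act (split0 k) (v j)))
  - fm_basis K (tup (fun j => act (split1 k) (v j)))
  - fm_basis K (tup (fun j => act (split2 k) (v j))).
Proof. by rewrite !mcompmB /= !lmon_compE !tup_ren. Qed.

(** Composing a generator on the left with [tup v] applies the three renamings to each entry. A
    relation is thus proved by exhibiting a tuple [v] in one more letter. *)
Lemma Ipr_tup n (k : 'I_n) p (v : 'I_p -> A n.+1) (v0 v1 v2 : 'I_p -> A n) :
  (forall j, act (split0 k) (v j) = v0 j) ->
  (forall j, act (split1 k) (v j) = v1 j) ->
  (forall j, act (split2 k) (v j) = v2 j) ->
  I p n (fm_basis K (tup v0) - fm_basis K (tup v1) - fm_basis K (tup v2)).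
Proof.
move=> /funext<- /funext<- /funext<-.
by rewrite -comp_split_rel; apply/lideal_comp/Ipr_split_rel.
Qed.

Definition kill n (k j : 'I_n) : option 'I_n := if j == k then None else Some j.
(** Taking an element of [A 1] as argument allows x_k and its inverse to be treated together. *)
Definition place n (k : 'I_n) : mhomType (A 1) (A n) := act (fun _ => Some k).
(** Occurrences of x_k move to the right letter of the pair, which frees the left one for a singled
    out occurrence. *)
Definition up n (k : 'I_n) : mhomType (A n) (A n.+1) :=
  act (fun j => Some (lift (widen_ord (leqnSn n) k) j)).

Section SplitValues.
Variables (n : nat) (k : 'I_n).
Local Notation km := (widen_ord (leqnSn n) k).
Local Notation kp := (lift ord0 k).

Let kpE : kp = lift km k. Proof. by apply: val_inj; rewrite /= /bump leqnn. Qed.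
Let kmE : km = lift kp k. Proof. by apply: val_inj; rewrite /= /bump ltnn. Qed.

Lemma split1_up j : split1 k (lift km j) = kill k j.
Proof.
rewrite /split1 /kill; case: eqP => [->|/eqP jk]; first by rewrite -kpE unlift_none.
have -> : lift km j = lift kp j; last by rewrite liftK.
apply: val_inj; rewrite /= /bump leq0n add1n.
by rewrite (ltn_neqAle k j) eq_sym (_ : (j == k :> nat) = false) //; apply: negPf jk.
Qed.

Lemma split0_up j : split0 k (lift km j) = Some j.
Proof. by rewrite /split0 -/(split1 k _) split1_up /kill; case: eqP => [->|]. Qed.

Lemma split2_up j : split2 k (lift km j) = Some j.
Proof. by rewrite /split2 liftK. Qed.

Lemma split1_km : split1 k km = Some k. Proof. by rewrite kmE /split1 liftK. Qed.
Lemma split0_km : split0 k km = Some k.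
Proof. by rewrite /split0 -/(split1 k _) split1_km. Qed.
Lemma split2_km : split2 k km = None. Proof. by rewrite /split2 unlift_none. Qed.

Lemma act0_up x : act (split0 k) (up k x) = x.
Proof. by rewrite act_comp -[RHS]act_some; apply: eq_act => j /=; rewrite split0_up. Qed.
Lemma act1_up x : act (split1 k) (up k x) = act (kill k) x.
Proof. by rewrite act_comp; apply: eq_act => j /=; rewrite split1_up. Qed.
Lemma act2_up x : act (split2 k) (up k x) = x.
Proof. by rewrite act_comp -[RHS]act_some; apply: eq_act => j /=; rewrite split2_up. Qed.
Lemma act0_km x : act (split0 k) (place km x) = place k x.
Proof. by rewrite act_comp /= split0_km. Qed.
Lemma act1_km x : act (split1 k) (place km x) = place k x.
Proof. by rewrite act_comp /= split1_km. Qed.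
Lemma act2_km x : act (split2 k) (place km x) = 1%g.
Proof. by rewrite act_comp /= split2_km act_none. Qed.
Lemma kill_kill x : act (kill k) (act (kill k) x) = act (kill k) x.
Proof.
by rewrite act_comp; apply: eq_act => j; rewrite /kill; case: eqP => //= /eqP/negPf->.
Qed.
Lemma kill_at x : act (kill k) (place k x) = 1%g.
Proof. by rewrite act_comp /= /kill eqxx act_none. Qed.

End SplitValues.

Definition upd p T (v : 'I_p -> T) (i : 'I_p) (x : T) (j : 'I_p) : T :=
  if j == i then x else v j.

Lemma Ipr_split n (k : 'I_n) p (v v1 v2 : 'I_p -> A n) i a b z :
  v i = (a * place k z * b)%g ->
  v1 =1 upd (fun j => act (kill k) (v j)) i
          (act (kill k) a * place k z * act (kill k) b)%g ->
  v2 =1 upd v i (a * b)%g ->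
  I p n (fm_basis K (tup v) - fm_basis K (tup v1) - fm_basis K (tup v2)).
Proof.
move=> vi vj1 vj2; pose km := widen_ord (leqnSn n) k.
apply: (Ipr_tup (k := k) (v := upd (fun j => up k (v j)) i
  (up k a * place km z * up k b)%g)) => j; rewrite ?vj1 ?vj2 /upd; case: eqP => [ji|_];
  first rewrite ?ji ?vi.
all: by rewrite ?gmulfM ?act0_up ?act1_up ?act2_up ?act0_km ?act1_km ?act2_km ?mulg1.
Qed.

(** Without x_k the three renamings of the lifted tuple agree, so the relation reads u - u - u =
    -u. *)
Lemma Ipr_kill n (k : 'I_n) p (v : 'I_p -> A n) :
  I p n (fm_basis K (tup (fun j => act (kill k) (v j)))).
Proof.
set u := fm_basis K _; have -> : u = - (u - u - u) by rewrite subrr sub0r opprK.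
rewrite -scaleN1r; apply: smodZ.
apply: (Ipr_tup (k := k) (v := fun j => up k (act (kill k) (v j)))) => j.
all: by rewrite ?act0_up ?act1_up ?act2_up ?kill_kill.
Qed.

(** Put [z] on the left letter and [z'] on the right one, next to each other, with x_k removed
    elsewhere. Merging cancels them and leaves a tuple without x_k, which lies in the ideal; the two
    deletions give [v1] and [v2]. *)
Lemma Ipr_inv n (k : 'I_n) p (v v1 v2 : 'I_p -> A n) i a b z z' :
  (z * z' = 1)%g ->
  v1 =1 upd (fun j => act (kill k) (v j)) i
          (act (kill k) a * place k z * act (kill k) b)%g ->
  v2 =1 upd (fun j => act (kill k) (v j)) i
          (act (kill k) a * place k z' * act (kill k) b)%g ->
  I p n (fm_basis K (tup v1) + fm_basis K (tup v2)).
Proof.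
move=> zz' vj1 vj2; pose km := widen_ord (leqnSn n) k.
set U := fm_basis K (tup v1); set U' := fm_basis K (tup v2).
pose U0 : freemod K _ := fm_basis K (tup (fun j =>
  act (kill k) (upd v i (a * b)%g j))).
have -> : U + U' = (-1) *: (U0 - U - U') + U0.
  by rewrite scaleN1r !opprD !opprK [RHS]addrC !addrA subrr add0r.
apply: smodP; last exact: Ipr_kill.
apply: (Ipr_tup (k := k) (v := upd (fun j => up k (act (kill k) (v j))) i
  (up k (act (kill k) a) * place km z * up k (place k z') *
   up k (act (kill k) b))%g)) => j.
all: rewrite ?vj1 ?vj2 /upd; case: eqP => _.
all: rewrite ?gmulfM ?act0_up ?act1_up ?act2_up ?kill_kill //.
- have zz1 : (place k z * place k z' = 1)%g by rewrite -gmulfM zz' gmulf1.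
  by rewrite act0_km -(mulgA _ (place k z)) zz1 mulg1.
- by rewrite act1_km kill_at mulg1.
- by rewrite act2_km mulg1.
Qed.

End PrimitiveRelations.

(** * Compatibility of groupification with the ideals and their idealizers *)

Section Groupification.
Variable K : comPzRingType.
Local Notation h := (lmonad_map K groupification).
Local Notation IW := (Ipr K Wop).
Local Notation IF := (Ipr K Fop).

Lemma groupify_basis m n (f : Wop n m) :
  h m n (fm_basis K f) = fm_basis K (groupification n m f).
Proof. exact: linext_basis. Qed.

Lemma groupify_ren m n (t : 'I_m -> option 'I_n) :
  groupification n m (ren monoid_family t) = ren group_family t.
Proof.
apply: renP => j; rewrite [LHS]fg_lift_gen.
have -> : (ren monoid_family t : mhomType (free_monoid m) (free_monoid n)) (fw_gen j)
  = oapp (@fw_gen n) 1%g (t j) by exact: (@fgenv_ren monoid_family).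
by case: (t j) => [i|]; [apply: fw_lift_gen | apply: gmulf1].
Qed.

Lemma groupify_split_rel n (k : 'I_n) :
  h n.+1 n (split_rel K monoid_family k) = split_rel K group_family k.
Proof. by rewrite /split_rel !linearB !groupify_basis !groupify_ren. Qed.

Fact groupify_preim_comp p m n (g : lmonad K Wop p m) (f : lmonad K Wop m n) :
  IF m n (h m n f) -> IF p n (h p n (mcomp g f)).
Proof. by rewrite mmor_comp; apply: lideal_comp. Qed.
Fact groupify_preim0 m n : IF m n (h m n 0).
Proof. by rewrite raddf0; apply: smod0. Qed.
Fact groupify_preimP m n (a : K) (f g : lmonad K Wop m n) :
  IF m n (h m n f) -> IF m n (h m n g) -> IF m n (h m n (a *: f + g)).
Proof. by rewrite linearP; apply: smodP. Qed.

(** The preimage of [IF] is a left ideal, and it contains the generators. *)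
Lemma groupify_Ipr m n (f : lmonad K Wop m n) : IW m n f -> IF m n (h m n f).
Proof.
apply: (Ipr_min (J := @LIdeal K nat (lmonad K Wop)
  (fun m n => Submod (@groupify_preim0 m n) (@groupify_preimP m n))
  groupify_preim_comp)) => {f}n k.
by rewrite /= -/(IF _ _ _) groupify_split_rel; apply: Ipr_split_rel.
Qed.

(** Membership in [Iz IF] is tested on all of [IF], not only on the image of [IW]. The elements [g]
    passing the test for all images of [Iz IW] form a left ideal, so the generators suffice. *)
Definition stab_mem p m (g : lmonad K Fop p m) : Prop :=
  forall n (f : lmonad K Wop m n), Iz IW m n f -> IF p n (mcomp g (h m n f)).
Fact stab0 p m : @stab_mem p m 0.
Proof. by move=> n f _; rewrite mcomp0m; apply: smod0. Qed.
Fact stabP p m (a : K) (g g' : lmonad K Fop p m) :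
  stab_mem g -> stab_mem g' -> stab_mem (a *: g + g').
Proof.
by move=> sg sg' n f If; rewrite mcomp_linearl; apply: smodP; [apply: sg|apply: sg'].
Qed.
Fact stab_comp q p m (g' : lmonad K Fop q p) (g : lmonad K Fop p m) :
  stab_mem g -> stab_mem (mcomp g' g).
Proof. by move=> sg n f If; rewrite -mcompA; apply/lideal_comp/sg. Qed.

Lemma groupify_Iz m n (f : lmonad K Wop m n) : Iz IW m n f -> Iz IF m n (h m n f).
Proof.
move=> If p g Ig; suff : stab_mem g by apply.
move: p m g Ig {f If}; apply: (Ipr_min (J := @LIdeal K nat (lmonad K Fop)
  (fun m n => Submod (@stab0 m n) (@stabP m n)) stab_comp)) => n' k l f If.
(* A generator over groups is the image of one over monoids, on which [f] acts within [IW]. *)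
rewrite -groupify_split_rel -mmor_comp; apply/groupify_Ipr/If.
exact: Ipr_split_rel.
Qed.

End Groupification.

(** * Reduction of tuples of positive words to multilinear ones *)

Section MultilinearWords.
Variable K : comPzRingType.
Local Notation I := (Ipr K Wop).
Local Notation tupW := (@tup monoid_family _ _).

Lemma act_fw m n (t : 'I_m -> option 'I_n) (w : free_monoid m) :
  act monoid_family t w = pmap t w.
Proof.
elim: w => [|i w IHw]; first exact: gmulf1.
rewrite -[i :: w]/(fw_gen i * w)%g gmulfM IHw.
have -> : act monoid_family t (fw_gen i) = oapp (@fw_gen n) 1%g (t i).
  exact: (@act_gen monoid_family).
by rewrite /=; case: (t i).
Qed.

Lemma pmap_kill n (k : 'I_n) w : pmap (kill k) w = filter (predC1 k) w.
Proof. by elim: w => //= i w ->; rewrite /kill; case: eqP. Qed.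

Definition letters m n (v : 'I_m -> seq 'I_n) k : nat := (\sum_i count_mem k (v i))%N.
Definition multilinear m n (v : 'I_m -> seq 'I_n) := forall k, letters v k = 1%N.

Definition multilinear_comb m n (u : lmonad K Wop m n) :=
  forall f : Wop n m, fm_coef f u != 0 ->
    multilinear (fgenv (f : fhom monoid_family n m)).

Lemma multilinear_combP m n (a : K) (u v : lmonad K Wop m n) :
  multilinear_comb u -> multilinear_comb v -> multilinear_comb (a *: u + v).
Proof.
move=> mu mv f; rewrite fm_coefD fm_coefZ.
case: (fm_coef f u =P 0) => [->|/eqP/mu//].
by rewrite mulr0 add0r => /mv.
Qed.

(** By induction on the total length. If some letter is absent, the tuple lies in the ideal. If some
    letter occurs at least twice, [Ipr_split] applies at one occurrence: [v1] loses all the others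
    and [v2] loses that one, so both are shorter. *)
Lemma word_multilinear m n (v : 'I_m -> free_monoid n) :
  exists2 u, multilinear_comb u & I m n (fm_basis K (tupW v) - u).
Proof.
have [N] := ubnP (\sum_i size (v i : seq 'I_n))%N; elim: N v => // N IHN v leN.
case: (pselect (multilinear v)) => [mv|/existsNP[k /eqP v_k]].
  exists (fm_basis K (tupW v)); last by rewrite subrr; apply: smod0.
  move=> f; rewrite /fm_coef monalg.mcoeffU; 
  case: (tupW v =P f) => [<- _|_]; last by rewrite mulr0n eqxx.
  by move=> k; rewrite -(mv k); apply: eq_bigr => i _; rewrite fgenv_lift.
have [v_k0|v_kn0] := posnP (letters v k).
  exists 0; first by move=> f; rewrite fm_coef0 eqxx.
  rewrite subr0 (eq_tup (w := fun i => act monoid_family (kill k) (v i))).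
    exact: Ipr_kill.
  move=> i; rewrite act_fw pmap_kill; symmetry; apply/all_filterP/allP => j jv /=.
  apply: contraTneq jv => ->; rewrite -has_pred1 has_count -leqNgt.
  by rewrite -v_k0 /letters (bigD1 i) //= leq_addr.
have [i0 k_v] : exists i0, k \in (v i0 : seq 'I_n).
  apply/not_existsP => kNv; move: v_kn0; rewrite lt0n => /eqP[].
  by apply: big1 => i _; apply/count_memPn/negP/kNv.
have [a [b v_ab]] : exists a b, v i0 = (a : seq 'I_n) ++ k :: b.
  by case/splitPr: k_v => a b; exists a, b.
pose v1 : 'I_m -> free_monoid n := upd (fun i => filter (predC1 k) (v i)) i0
  (filter (predC1 k) a ++ k :: filter (predC1 k) b).
pose v2 : 'I_m -> free_monoid n := upd v i0 (a ++ b).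
have split_v : I m n (fm_basis K (tupW v) - fm_basis K (tupW v1) - fm_basis K (tupW v2)).
  have at_k : place monoid_family k (fw_gen ord0) = fw_gen k.
    exact: (@act_gen monoid_family).
  apply: (@Ipr_split K monoid_family n k m v v1 v2 i0 a b (fw_gen ord0)).
  - by rewrite at_k v_ab -mulgA.
  - move=> i; rewrite at_k !act_fw !pmap_kill -mulgA /v1 /upd.
    by case: eqP => _ //; rewrite act_fw pmap_kill.
  - by [].
have size1 : (\sum_i size (v1 i : seq 'I_n) + letters v k =
              \sum_i size (v i : seq 'I_n) + 1)%N.
  (* Writing 1 as the sum of the indicator of [i0] makes the identity hold entry by entry. *)
  rewrite -[1%N](_ : \sum_(i < m) (i == i0) = 1)%N.
    rewrite -!big_split; apply: eq_bigr => i _; rewrite /v1 /upd /=.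
    case: eqP => [->|_]; rewrite ?v_ab ?size_cat ?count_cat /= !size_filter.
      rewrite eqxx -(count_predC (pred1 k) a) -(count_predC (pred1 k) b).
      rewrite -![predC1 k]/(predC (pred1 k)) add1n.
      by move: (count _ a) (count _ a) (count _ b) (count _ b) => x y z t; lia.
    by rewrite addn0 addnC count_predC.
  by rewrite (bigD1 i0) //= eqxx big1 // => i /negPf->.
have size2 : (\sum_i size (v2 i : seq 'I_n) + 1 = \sum_i size (v i : seq 'I_n))%N.
  rewrite -[1%N](_ : \sum_(i < m) (i == i0) = 1)%N.
    rewrite -!big_split; apply: eq_bigr => i _; rewrite /v2 /upd /=.
    by case: eqP => [->|_]; rewrite ?addn0 // v_ab !size_cat /= addn1 addnS.
  by rewrite (bigD1 i0) //= eqxx big1 // => i /negPf->.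
have [|u1 mu1 Iu1] := IHN v1; first by lia.
have [|u2 mu2 Iu2] := IHN v2; first by lia.
exists (1 *: u1 + u2); first exact: multilinear_combP.
set w := fm_basis K (tupW v) in split_v *.
set w1 := fm_basis K (tupW v1) in split_v Iu1.
set w2 := fm_basis K (tupW v2) in split_v Iu2.
have -> : w - (1 *: u1 + u2) = 1 *: (w - w1 - w2) + (1 *: (w1 - u1) + (w2 - u2)).
  by rewrite !scale1r opprD [in RHS]addrACA !addrA subrK addrAC subrK addrAC.
by apply: smodP => //; apply: smodP.
Qed.

Lemma multilinear_decomp m n (w : lmonad K Wop m n) :
  exists2 u, multilinear_comb u & I m n (w - u).
Proof.
rewrite (fm_decomp w); elim: (fm_supp w : seq _) => [|f s [u mu Iu]].
  rewrite big_nil; exists 0; first by move=> f; rewrite fm_coef0 eqxx.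
  by rewrite subrr; apply: smod0.
have [v ->] := tup_surj (A := monoid_family) f.
have [u' mu' Iu'] := word_multilinear v; rewrite big_cons.
exists (fm_coef (tupW v) w *: u' + u); first exact: multilinear_combP.
by rewrite opprD addrACA -scalerBr; apply: smodP.
Qed.

End MultilinearWords.

(** * Reduction of tuples of signed words to positive ones *)

Section SignedWords.
Variable K : comPzRingType.
Local Notation h := (lmonad_map K groupification).
Local Notation I := (Ipr K Fop).
Local Notation tupF := (@tup group_family _ _).

Definition act_letter m n (t : 'I_m -> option 'I_n) (x : 'I_m * bool) :
  option ('I_n * bool) := omap (fun i => (i, x.2)) (t x.1).

(** Renaming may be carried out on any representative word, reduced or not. *)
Lemma act_fg m n (t : 'I_m -> option 'I_n) (w : seq ('I_m * bool)) :
  act group_family t (fg_mk w) = fg_mk (pmap (act_letter t) w).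
Proof.
elim: w => [|[i b] w IHw]; first exact: gmulf1.
rewrite fg_mk_cons gmulfM IHw.
have -> : act group_family t (fg_letter (@fg_gen m) (i, b)) =
    oapp (fg_letter (@fg_gen n)) 1%g (act_letter t (i, b)).
  have ti : act group_family t (fg_gen i) = oapp (@fg_gen n) 1%g (t i).
    exact: (@act_gen group_family).
  case: b; first by rewrite -[fg_letter _ _]/(fg_gen i) ti /act_letter; case: (t i).
  rewrite -[fg_letter _ _]/(fg_gen i)^-1%g gmulfV ti /act_letter.
  by case: (t i) => //=; rewrite invg1.
by rewrite /=; case: act_letter => [x|] /=; rewrite ?mul1g // fg_mk_cons.
Qed.

Lemma fg_mk_cat n (u v : seq ('I_n * bool)) : fg_mk (u ++ v) = (fg_mk u * fg_mk v)%g.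
Proof. by apply: val_inj; rewrite !val_fg_mk reduce_catl reduce_catr. Qed.

Lemma fg_mk_positive n (w : seq 'I_n) :
  fg_mk [seq (i, true) | i <- w] = WtoF n w.
Proof.
elim: w => [|i w IHw]; first by rewrite gmulf1.
rewrite map_cons fg_mk_cons IHw -[i :: w]/(fw_gen i * w)%g gmulfM; congr (_ * _)%g.
exact/esym/fw_lift_gen.
Qed.

Definition negs n (w : seq ('I_n * bool)) := count (fun x => ~~ x.2) w.

Lemma negs_pmap m n (t : 'I_m -> option 'I_n) w :
  (negs (pmap (act_letter t) w) <= negs w)%N.
Proof.
elim: w => //= x w IHw; rewrite /act_letter; case: (t x.1) => [i|] /=.
  by rewrite leq_add2l.
by rewrite (leq_trans IHw) ?leq_addl.
Qed.

(** Single out an occurrence of x_k^-1. Modulo the ideal, [Ipr_split] gives w = w1 false + w2 and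
    [Ipr_inv] gives w1 false = - w1 true. The words behind [w1 true] and [w2] have fewer negative
    letters, whence the witness [t2 - t1]. *)
Lemma signed_word m n (v : 'I_m -> seq ('I_n * bool)) :
  exists t : lmonad K Wop m n,
    I m n (fm_basis K (tupF (fun i => fg_mk (v i))) - h m n t).
Proof.
have [N] := ubnP (\sum_i negs (v i))%N; elim: N v => // N IHN v leN.
have [v_pos|[i0 v_neg]] : (forall i, negs (v i) = 0%N) \/ exists i, (0 < negs (v i))%N.
- case: (pselect (exists i, (0 < negs (v i))%N)) => [|/forallNP v0]; [by right|left=> i].
  by apply/eqP; rewrite -leqn0 leqNgt; apply/negP/v0.
(* With no negative letter left, the signs can simply be forgotten. *)
- exists (fm_basis K (tup (A := monoid_family) (fun i => map fst (v i)))).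
  rewrite groupify_basis; set f := tupF _; set g := groupification _ _ _.
  have -> : f = g; last by rewrite subrr; apply: smod0.
  apply: (@fhomP group_family) => i; rewrite [LHS]fgenv_lift [RHS]fg_lift_gen.
  rewrite -[X in WtoF n X]/(fgenv (tup (A := monoid_family) _ : fhom _ _ _) i) fgenv_lift.
  rewrite -fg_mk_positive -map_comp; congr fg_mk.
  move: (v_pos i); elim: (v i) => //= -[j [|]] //= w IHw negs_w.
  by rewrite -IHw.
have [k [a [b v_ab]]] : exists k a b, v i0 = a ++ (k, false) :: b.
  move: v_neg; rewrite -has_count => /hasP[[k []] // kv _].
  by exists k; case/splitPr: kv => a b; exists a, b.
pose kl (w : seq ('I_n * bool)) := pmap (act_letter (kill k)) w.
pose v1 s := upd (fun i => kl (v i)) i0 (kl a ++ (k, s) :: kl b).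
pose v2 := upd v i0 (a ++ b).
have at_k s : place group_family k (fg_letter (@fg_gen 1) (ord0, s)) = fg_mk [:: (k, s)].
  have ak : place group_family k (fg_gen ord0) = fg_gen k.
    exact: (@act_gen group_family).
  by case: s; rewrite /fg_letter ?gmulfV ak.
have mk_k s (c d : seq ('I_n * bool)) :
    fg_mk (c ++ (k, s) :: d) = (fg_mk c * fg_mk [:: (k, s)] * fg_mk d)%g.
  by rewrite -cat1s catA !fg_mk_cat.
set w := fm_basis K _.
pose w1 s := fm_basis K (tupF (fun i => fg_mk (v1 s i))).
pose w2 := fm_basis K (tupF (fun i => fg_mk (v2 i))).
have v1E s : (fun i => fg_mk (v1 s i)) =1
    upd (fun j => act group_family (kill k) (fg_mk (v j))) i0
      (act group_family (kill k) (fg_mk a) *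
       place group_family k (fg_letter (@fg_gen 1) (ord0, s)) *
       act group_family (kill k) (fg_mk b))%g.
  move=> i; rewrite /v1 /upd at_k !act_fg; by case: eqP => _ //; apply: mk_k.
have split_v : I m n (w - w1 false - w2).
  apply: (@Ipr_split K group_family n k m _ _ _ i0 (fg_mk a) (fg_mk b) _ _ (v1E false)).
    by rewrite at_k v_ab mk_k.
  by move=> i; rewrite /v2 /upd; case: eqP => // _; rewrite fg_mk_cat.
have inv_v : I m n (w1 false + w1 true).
  by apply: (@Ipr_inv K group_family n k m _ _ _ i0 (fg_mk a) (fg_mk b) _ _ _
               (v1E false) (v1E true)); rewrite /fg_letter mulVg.
have sum_ltn (u : 'I_m -> seq ('I_n * bool)) :
    (forall i, i != i0 -> negs (u i) <= negs (v i))%N -> (negs (u i0) < negs (v i0))%N ->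
    (\sum_i negs (u i) < N)%N.
  move=> u_le u_lt; apply: leq_trans (_ : _ < \sum_i negs (v i))%N _ => //.
  rewrite (bigD1 i0) //= [ltnRHS](bigD1 i0) //= -addSn leq_add //.
  exact: leq_sum.
have [|t1 It1] := IHN (v1 true).
- apply: sum_ltn => [i|]; rewrite /v1 /upd; first by move/negPf->; apply: negs_pmap.
  rewrite eqxx v_ab /negs !count_cat /= add0n addnS ltnS.
  by apply: leq_add; apply: negs_pmap.
have [|t2 It2] := IHN v2.
- apply: sum_ltn => [i|]; rewrite /v2 /upd; first by move/negPf->.
  by rewrite eqxx v_ab /negs !count_cat /= addnS.
exists (t2 - t1).
have -> : w - h m n (t2 - t1) = 1 *: (w - w1 false - w2) +
    (1 *: (w1 false + w1 true) + ((-1) *: (w1 true - h m n t1) + (w2 - h m n t2))).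
  rewrite linearB opprB scaleN1r !scale1r opprB.
  rewrite (addrA (w1 false + w1 true)) (addrC _ (- w1 true)) (addrA (w1 false + _)) addrK.
  by rewrite (addrACA (w1 false)) -(addrA w (- w1 false)) -opprD [RHS]addrA subrK.
by do 3!apply: smodP => //.
Qed.

Lemma groupify_onto m n (s : lmonad K Fop m n) :
  exists t : lmonad K Wop m n, I m n (s - h m n t).
Proof.
rewrite (fm_decomp s); elim: (fm_supp s : seq _) => [|f r [t It]].
  by rewrite big_nil; exists 0; rewrite raddf0 subrr; apply: smod0.
have [t' It'] := signed_word (fun i => val (fgenv (f : fhom group_family n m) i)).
rewrite big_cons; exists (fm_coef f s *: t' + t).
rewrite linearP opprD addrACA -scalerBr; apply: smodP => //.
suff {1}-> : f = tupF (fun i => fg_mk (val (fgenv (f : fhom group_family n m) i))) by [].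
by apply: (@fhomP group_family) => i; rewrite fgenv_lift fg_mk_val.
Qed.

End SignedWords.

(** * Coefficients of the Magnus expansion *)

Section MagnusCoefficients.
Variable K : comPzRingType.
Local Notation h := (lmonad_map K groupification).

Definition sign (b : bool) : K := if b then 1 else -1.

(* For t without repetitions: the coefficient of the monomial t in the image   *)
(* of v under the Magnus expansion x_i |-> 1 + X_i.  Monomials with a repeated *)
(* letter do not matter, so that x_i^-1 |-> 1 - X_i.                           *)
Fixpoint magnus n (v : seq ('I_n * bool)) (t : seq 'I_n) : K :=
  match t, v with
  | [::], _ => 1
  | _ :: _, [::] => 0
  | a :: t', x :: v' => magnus v' t + (if x.1 == a then sign x.2 * magnus v' t' else 0)
  end.

Arguments magnus : simpl never.

Lemma magnus0 n (v : seq ('I_n * bool)) : magnus v [::] = 1. Proof. by case: v. Qed.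

Lemma magnus_cons n x (v : seq ('I_n * bool)) a t : magnus (x :: v) (a :: t) =
  magnus v (a :: t) + if x.1 == a then sign x.2 * magnus v t else 0.
Proof. by []. Qed.

Lemma magnus_notin n (x : 'I_n * bool) v t : x.1 \notin t ->
  magnus (x :: v) t = magnus v t.
Proof.
case: t => [|a t]; rewrite ?magnus0 // inE negb_or => /andP[/negPf xa _].
by rewrite magnus_cons xa addr0.
Qed.

(** The linear terms of the two letters cancel; their quadratic term would repeat a letter, which
    [uniq t] excludes. *)
Lemma magnus_cancel n (x : 'I_n * bool) v t : uniq t ->
  magnus (x :: linv x :: v) t = magnus v t.
Proof.
case: t => [|a t]; rewrite ?magnus0 // => /andP[aNt _].
rewrite !(magnus_cons _ _ a) [(linv x).1]/=; case: eqP => [xa|_]; last by rewrite !addr0.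
rewrite magnus_notin ?[(linv x).1]/= ?xa // -addrA -mulrDl /sign /=.
by case: x.2; rewrite ?addNr ?subrr mul0r addr0.
Qed.

Lemma magnus_reduce n (v : seq ('I_n * bool)) t : uniq t ->
  magnus (reduce v) t = magnus v t.
Proof.
elim: v t => // x v IHv t ut.
have -> : magnus (x :: v) t = magnus (x :: reduce v) t.
  case: t ut => [|a t] /= ut; rewrite ?magnus0 // !magnus_cons !IHv //.
  by case/andP: ut.
rewrite /=; case: (reduce v) => [|y w] //=; case: eqP => [->|//].
by rewrite magnus_cancel.
Qed.

(** For a positive word the coefficient counts the occurrences of [t] as a subword of [v]; a subword
    at least as long as [v] is [v] itself. *)
Lemma magnus_positive n (v t : seq 'I_n) : (size v <= size t)%N ->
  magnus [seq (i, true) | i <- v] t = (v == t)%:R.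
Proof.
elim: v t => [|b v IHv] [|a t] // svt; rewrite ?magnus0 //.
rewrite map_cons magnus_cons !IHv // ?leqW //=.
rewrite eqseq_cons mul1r; case: (v =P a :: t) svt => [-> /=|_ _]; first by rewrite ltnn.
by rewrite add0r; case: (b == a).
Qed.

Lemma pmap_letter m n (t : 'I_m -> option 'I_n) j s w :
  pmap (act_letter t) ((j, s) :: w) =
  if t j is Some i then (i, s) :: pmap (act_letter t) w else pmap (act_letter t) w.
Proof. by rewrite /= [act_letter _ _]/act_letter /=; case: (t j). Qed.

Section SplitLetters.
Variables (n : nat) (k : 'I_n).
Local Notation p0 := (pmap (act_letter (split0 k))).
Local Notation p1 := (pmap (act_letter (split1 k))).
Local Notation p2 := (pmap (act_letter (split2 k))).

Variant split_spec (j : 'I_n.+1) : option 'I_n -> option 'I_n -> option 'I_n -> Prop :=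
| SplitOther i of i != k : split_spec j (Some i) (Some i) (Some i)
| SplitLeft : split_spec j (Some k) (Some k) None
| SplitRight : split_spec j (Some k) None (Some k).

Lemma split_letterP j : split_spec j (split0 k j) (split1 k j) (split2 k j).
Proof.
case: (unliftP (widen_ord (leqnSn n) k) j) => [i ->|->].
  rewrite split0_up split1_up split2_up /kill; case: eqP => [->|/eqP ik]; by constructor.
by rewrite split0_km split1_km split2_km; constructor.
Qed.

(** The three renamings differ only in which letters x_k they produce, and [t] does not see
    these. *)
Lemma magnus_split_notin w t : k \notin t ->
  magnus (p1 w) t = magnus (p0 w) t /\ magnus (p2 w) t = magnus (p0 w) t.
Proof.
elim: w t => [|[j s] w IHw] t kNt //.
rewrite !pmap_letter; case: split_letterP => [i ik||]; last 2 first.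
- by rewrite !magnus_notin //; apply: IHw.
- by rewrite !magnus_notin //; apply: IHw.
case: t kNt => [|a t] kNt; rewrite ?magnus0 // !magnus_cons; have [-> ->] := IHw _ kNt.
by move: kNt; rewrite inE negb_or => /andP[_ /IHw[-> ->]].
Qed.

(** In any occurrence of [t] as a subword of [p0 w], its only x_k comes either from a left letter,
    kept by [p1], or from a right letter, kept by [p2]. *)
Lemma magnus_split w t : uniq t -> k \in t ->
  magnus (p0 w) t = magnus (p1 w) t + magnus (p2 w) t.
Proof.
elim: w t => [|[j s] w IHw] [|a t] // ut kt; first by rewrite /= addr0.
have IHa := IHw _ ut kt; case/andP: ut kt => aNt ut; rewrite inE => kt.
rewrite !pmap_letter; case: split_letterP => [i ik||]; rewrite /= !magnus_cons /=.
- rewrite IHa; case: eqP => [ia|_]; last by rewrite !addr0.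
  have {}kt : k \in t by move: kt; rewrite -ia eq_sym (negPf ik).
  by rewrite IHw // mulrDr addrACA.
(* If the head of the monomial is x_k, its tail avoids x_k and has the same coefficient under the
   three renamings. *)
- rewrite IHa addrAC; case: eqP => [ka|_]; last by rewrite !addr0.
  by congr (_ + _ * _ + _); rewrite -ka in aNt; have [->] := magnus_split_notin w aNt.
- rewrite IHa -addrA; case: eqP => [ka|_]; last by rewrite !addr0.
  by congr (_ + (_ + _ * _)); rewrite -ka in aNt; have [_ ->] := magnus_split_notin w aNt.
Qed.

End SplitLetters.
End MagnusCoefficients.

(** * Combinatorics of multilinear tuples *)

Section MultilinearTuples.
Variables (m n : nat) (t : 'I_m -> seq 'I_n).
Hypothesis mt : multilinear t.

Lemma multilinear_count k i : (count_mem k (t i) <= 1)%N.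
Proof. by rewrite -(mt k) /letters (bigD1 i) //= leq_addr. Qed.

Lemma multilinear_uniq i : uniq (t i).
Proof.
apply: count_mem_uniq => k; have := multilinear_count k i.
case: (boolP (k \in t i)) => [|/count_memPn->//].
by rewrite -has_pred1 has_count; case: (count_mem k (t i)) => [|[]].
Qed.

Lemma multilinear_in k : exists2 i, k \in t i & forall j, j != i -> k \notin t j.
Proof.
have [i k_t] : exists i, k \in t i.
  apply/not_existsP => kNt; have := mt k; rewrite /letters big1 // => i _.
  by apply/count_memPn/negP/kNt.
exists i => // j ji; apply/count_memPn/eqP; rewrite -leqn0 -ltnS.
have := mt k; rewrite /letters (bigD1 i) //= (bigD1 j) //= => <-.
move: k_t; rewrite -has_pred1 has_count => k_t.
by rewrite addnA ltn_addr // -[ltnLHS]add0n ltn_add2r.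
Qed.

(** Proved by double counting; it lets two multilinear tuples be compared through their lengths. *)
Lemma multilinear_size : (\sum_i size (t i) = n)%N.
Proof.
transitivity (\sum_k letters t k)%N; last first.
  by rewrite (eq_bigr _ (fun k _ => mt k)) sum1_card card_ord.
rewrite exchange_big; apply: eq_bigr => i _ /=.
elim: (t i) => [|a s IHs]; first by rewrite big1.
rewrite /= big_split -IHs (bigD1 a) //= eqxx big1 // => k; rewrite eq_sym.
by move/negPf->.
Qed.

End MultilinearTuples.

(** * Functionals vanishing on the ideal, and injectivity *)

Section MagnusFunctional.
Variable K : comPzRingType.
Local Notation h := (lmonad_map K groupification).
Local Notation IW := (Ipr K Wop).
Local Notation IF := (Ipr K Fop).
Local Notation tupF := (@tup group_family _ _).

Definition magnus_prod m n (t : 'I_m -> seq 'I_n) (f : Fop n m) : K^o :=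
  \prod_i magnus K (val (fgenv (f : fhom group_family n m) i)) (t i).
Definition magnus_fun m n (t : 'I_m -> seq 'I_n) : {linear lmonad K Fop m n -> K^o} :=
  linext (magnus_prod t).

Lemma magnus_act m n (s : 'I_m -> option 'I_n) (u : free_group m) t : uniq t ->
  magnus K (val (act group_family s u)) t = magnus K (pmap (act_letter s) (val u)) t.
Proof. by move=> ut; rewrite -{1}[u]fg_mk_val act_fg val_fg_mk magnus_reduce. Qed.

(** Exactly one entry of [t] contains x_k. The corresponding factor is additive by [magnus_split],
    and the other factors are the same in the three products. *)
Lemma magnus_prod_split n (k : 'I_n) m (v : 'I_m -> free_group n.+1) t :
  multilinear t ->
  magnus_prod t (tupF (fun j => act group_family (split0 k) (v j))) =
  magnus_prod t (tupF (fun j => act group_family (split1 k) (v j))) +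
  magnus_prod t (tupF (fun j => act group_family (split2 k) (v j))).
Proof.
move=> mt; have [i k_t kNt] := multilinear_in mt k.
have prodE s : magnus_prod t (tupF (fun j => act group_family s (v j))) =
    \prod_j magnus K (pmap (act_letter s) (val (v j))) (t j).
  apply: eq_bigr => j _; rewrite -magnus_act; last exact: multilinear_uniq.
  by congr (magnus K (val _) _); apply: (@fgenv_lift group_family).
rewrite !prodE !(bigD1 (P := xpredT) i) //= magnus_split //; last exact: multilinear_uniq.
rewrite mulrDl; congr (_ * _ + _ * _); apply: eq_bigr => j /kNt kNtj.
  by have [->] := magnus_split_notin K (val (v j)) kNtj.
by have [_ ->] := magnus_split_notin K (val (v j)) kNtj.
Qed.

(** Quantifying over [g] turns the common kernel of the functionals into a left ideal, as [Ipr_min]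
    requires; an identity [g] recovers the functionals themselves. *)
Definition magnus_null m n (f : lmonad K Fop m n) : Prop :=
  forall p (g : lmonad K Fop p m) t, multilinear t -> magnus_fun t (mcomp g f) = 0.
Fact magnus_null0 m n : @magnus_null m n 0.
Proof. by move=> p g t _; rewrite mcompm0; apply: linear0. Qed.
Fact magnus_nullP m n (a : K) (f f' : lmonad K Fop m n) :
  magnus_null f -> magnus_null f' -> magnus_null (a *: f + f').
Proof.
move=> nf nf' p g t mt; rewrite mcomp_linearr linearP.
by rewrite nf // nf' // scaler0 addr0.
Qed.
Fact magnus_null_comp p m n (g : lmonad K Fop p m) (f : lmonad K Fop m n) :
  magnus_null f -> magnus_null (mcomp g f).
Proof. by move=> nf q g' t mt; rewrite mcompA; apply: nf. Qed.

Lemma Ipr_magnus m n (f : lmonad K Fop m n) t :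
  IF m n f -> multilinear t -> magnus_fun t f = 0.
Proof.
move=> If mt; suff /(_ m (mone _ m) t mt) : magnus_null f by rewrite mcomp1m.
move: m n f If {t mt}; apply: (Ipr_min (J := @LIdeal K nat (lmonad K Fop)
  (fun m n => Submod (@magnus_null0 m n) (@magnus_nullP m n)) magnus_null_comp)).
move=> n k p g t mt; move: g; apply: (@fm_linear_ext K _ K^o _ (fun _ => 0)).
- by move=> a u v; rewrite mcomp_linearl linearP.
- by move=> a u v; rewrite scaler0 addr0.
move=> f; have [v ->] := tup_surj (A := group_family) f.
rewrite comp_split_rel !linearB /= !linext_basis magnus_prod_split //.
by rewrite -addrA -opprD subrr.
Qed.

Lemma magnus_delta m n (f g : Wop n m) :
  multilinear (fgenv (f : fhom monoid_family n m)) ->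
  multilinear (fgenv (g : fhom monoid_family n m)) ->
  magnus_prod (fgenv (f : fhom monoid_family n m)) (groupification n m g) = (g == f)%:R.
Proof.
set u := fgenv _; set v := fgenv _ => mu mv.
have prodE : magnus_prod u (groupification n m g) =
    \prod_i magnus K [seq (j, true) | j <- v i] (u i).
  apply: eq_bigr => i _; rewrite -[RHS]magnus_reduce; last exact: multilinear_uniq.
  rewrite -val_fg_mk fg_mk_positive; congr (magnus K (val _) _).
  exact: fg_lift_gen.
rewrite {}prodE; case: (g =P f) => [gf|fNg].
  by apply: big1 => i _; rewrite magnus_positive /u /v gf ?eqxx.
(* Otherwise every entry where the tuples differ would be strictly longer in [v], although both have
   total length [n]. At such an [i] the factor vanishes by [magnus_positive]. *)
have [i vui uv] : exists2 i, (size (v i : seq 'I_n) <= size (u i : seq 'I_n))%N &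
    (v i : seq 'I_n) != u i.
  apply: contrapT => Nuv; have uv i :
      (size (v i : seq 'I_n) <= size (u i : seq 'I_n))%N -> v i = u i.
    by move=> vu; apply: contrapT => /eqP uv; apply: Nuv; exists i.
  apply: fNg; apply: (@fhomP monoid_family) => i; apply: (uv); rewrite leqNgt.
  apply/negP => ltuv; have := multilinear_size mv; rewrite -{2}(multilinear_size mu).
  rewrite (bigD1 i) //= [RHS](bigD1 i) //= => /eqP; rewrite eqn_leq => /andP[+ _].
  apply/negP; rewrite -ltnNge -addSn leq_add // leq_sum // => j _.
  by case: (leqP (size (v j : seq 'I_n)) (size (u j : seq 'I_n))) => [/uv->//|/ltnW].
by rewrite (bigD1 i) //= magnus_positive // (negPf uv) mul0r.
Qed.

(** By [magnus_delta], the functionals are dual to the images of the multilinear tuples. *)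
Lemma magnus_multilinear m n (u : lmonad K Wop m n) (f : Wop n m) :
  multilinear_comb u -> multilinear (fgenv (f : fhom monoid_family n m)) ->
  magnus_fun (fgenv (f : fhom monoid_family n m)) (h m n u) = fm_coef f u.
Proof.
move=> mu mf; rewrite [in RHS](fm_decomp u) fm_coef_sum.
rewrite -[h m n u]/(\sum_(g <- fm_supp u)
  fm_coef g u *: fm_basis K (groupification n m g)).
rewrite linear_sum; apply: eq_bigr => g _; rewrite linearZ /= linext_basis fm_coefZ.
case: (fm_coef g u =P 0) => [->|/eqP/mu mg]; first by rewrite scale0r mul0r.
by rewrite magnus_delta // /fm_coef monalg.mcoeffU.
Qed.

(** Replace [f] by a multilinear combination [u] congruent to it. The image of [u] still lies in
    [IF], where the functionals vanish, and these read off the coefficients of [u]; so [u] is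
    zero. *)
Lemma groupify_Ipr_reflect m n (f : lmonad K Wop m n) : IF m n (h m n f) -> IW m n f.
Proof.
move=> hf; have [u mu fu] := multilinear_decomp f.
have hu : IF m n (h m n u).
  have -> : u = f - (f - u) by rewrite subKr.
  by rewrite linearB; apply: smodB => //; apply: groupify_Ipr.
suff u0 : u = 0 by rewrite u0 subr0 in fu.
apply: fm_ext => g; rewrite fm_coef0; apply: contrapT => /eqP gu.
have mg := mu g gu; move: gu; rewrite -(magnus_multilinear mu mg).
by rewrite (Ipr_magnus hu mg) eqxx.
Qed.

End MagnusFunctional.

Theorem theorem4 (K : comPzRingType) :
  exists (phi : monad_mor (Phi K Wop) (Phi K Fop))
         (psi : bimod_mor (canon_bimod (Ipr K Wop))
                  (bimod_restr (lmonad_map K groupification) phi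
                     (canon_bimod (Ipr K Fop)))),
    [/\ induces_eigen (lmonad_map K groupification) phi,
        induces_canon psi,
        monad_iso phi & bimod_iso psi].
Proof.
apply: induced_isos.
- by move=> m n f; split; [apply: groupify_Ipr | apply: groupify_Ipr_reflect].
- by move=> m n f; apply: groupify_Iz.
- by move=> m n s; apply: groupify_onto.
Qed.
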